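(* Let $b\ne0$ be a complex constant and let $n$ be a positive integer. Let $A(z),B(z)\not\equiv0$ be analytic functions in $D(0,R)=\{z\in\mathbb{C}:0<|z|<R\}$ with $\max\{\sigma(A,0),\sigma(B,0)\}<n$. Then every solution $f(z)\not\equiv0$ of the differential equation $$f''+A(z)f'+B(z)\exp\left\{\frac{b}{z^n}\right\}f=0$$ satisfies $\sigma_2(f,0)=n$.
   Context: For an analytic function $f$ in $D(0,R)=\{z\in\mathbb{C}:0<|z|<R\}$ let $M_0(r,f)=\max\{|f(z)|:|z|=r\}$. The order and the hyper-order (second iterated order) of $f$ near $0$ are $$\sigma(f,0)=\limsup_{r\to0}\frac{\log^+\log^+M_0(r,f)}{-\log r},\qquad \sigma_2(f,0)=\limsup_{r\to0}\frac{\log^+\log^+\log^+M_0(r,f)}{-\log r},$$ where $\log^+x=\max\{\log x,0\}$. *)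

(* Defs.v *)
From Stdlib Require Export Reals.
From Coquelicot Require Export Coquelicot.

Open Scope R_scope.

Definition Cexp (z : C) : C :=
  (exp (Re z) * cos (Im z), exp (Re z) * sin (Im z)).

Definition punctured_disc (rho : R) (z : C) : Prop := 0 < Cmod z < rho.

(* Functions are total on C; only the values on [D] are constrained. *)
Definition analytic_at (f : C -> C) (z0 : C) : Prop :=
  exists (a : nat -> C) (rho : R), 0 < rho /\
    forall z : C, Cmod (z - z0)%C < rho ->
      @is_pseries C_AbsRing C_NormedModule a (z - z0)%C (f z).

Definition analytic_in (D : C -> Prop) (f : C -> C) : Prop :=
  forall z : C, D z -> analytic_at f z.

Definition not_identically_zero (D : C -> Prop) (f : C -> C) : Prop :=
  exists z : C, D z /\ f z <> RtoC 0.

(* The supremum over the circle is a maximum when [f] is continuous there. *)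
Definition M0 (r : R) (f : C -> C) : R :=
  real (Lub_Rbar (fun y => exists z : C, Cmod z = r /\ y = Cmod (f z))).

(* [ln] is 0 at 0, so that [logp 0 = 0], the usual convention for log^+. *)
Definition logp (x : R) : R := Rmax (ln x) 0.

(* Limit superior along a filter, with values in the extended reals. *)
Definition LimSup (F : (R -> Prop) -> Prop) (g : R -> R) : Rbar :=
  Rbar_glb (fun L => exists V : R -> Prop,
    F V /\ L = Lub_Rbar (fun y => exists r : R, V r /\ y = g r)).

Definition order0 (f : C -> C) : Rbar :=
  LimSup (at_right 0) (fun r => logp (logp (M0 r f)) / - ln r).

Definition hyper_order0 (f : C -> C) : Rbar :=
  LimSup (at_right 0) (fun r => logp (logp (logp (M0 r f))) / - ln r).

Definition Rbar_max (x y : Rbar) : Rbar := if Rbar_le_dec x y then y else x.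

(* [f] solves f'' + P f' + Q f = 0 on [D], with complex derivatives. *)
Definition is_solution (D : C -> Prop) (P Q f : C -> C) : Prop :=
  exists f1 f2 : C -> C, forall z : C, D z ->
    @is_derive C_AbsRing C_NormedModule f z (f1 z) /\
    @is_derive C_AbsRing C_NormedModule f1 z (f2 z) /\
    (f2 z + P z * f1 z + Q z * f z)%C = RtoC 0.

(* Main.v *)
Require Import Defs.
From Stdlib Require Import Reals ZArith Lra Lia Psatz Classical ClassicalEpsilon.
From Coquelicot Require Import Coquelicot.

(** [f] has hyper-order at most [n] by Gronwall's inequality: on [r <= |z| <= r0]
the coefficients of the equation are bounded by [exp (r ^ -(n + eps))], hence
along every ray [|f|^2 + |f'|^2] grows at most by a factor
[exp (exp (r ^ -(n + eps)))] ([gronwall_ray], [hyper_order_upper]).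

For the opposite inequality suppose that [log log log |f| <= be log (1/r)] near
0 for some [be < n], and take [be] so large that [log log |A|] and
[log log |B|] obey the same bound.  The equation gives
[|B exp (b / z^n)| <= |f''/f| + |A| |f'/f|].  Around a point [p] with
[b / p^n > 0], [|p| = s], the exponential is at least [exp (c s^-n)], so a
contradiction follows once a point close to [p] is found where [B] is not too
small and the logarithmic derivatives of [f] are at most
[exp (s ^ -(be + eps))].  Nevanlinna theory would provide such a point; here it
comes from the maximum principle alone.

- The maximum principle is read off from second-order expansions: at an
  interior maximum of a real function
  [phi (z + h) = phi z + Re (p h) + Re (q h^2) + s |h|^2 + o(|h|^2)]
  one has [p = 0] and [|q| <= -2 s] ([real_jet_max]).  For a holomorphic [G],
  [ln |G|^2] has such an expansion with [s = 0], [p = 2 G'/G] and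
  [q = (G'/G)'] ([real_jet_ln_Cmod2]).
- Comparing [ln |G|^2] with [al ln |z - c|^2 + eps |z - c|^2] gives the maximum
  principle for [|G| |z - c|^al] on annuli ([annulus_max]), hence Hadamard's
  three circles theorem ([three_circles]).  A function which is tiny on a
  small disc near [p] is then small on a chain of discs around the circle
  [|z| = s], hence on that circle, and hence at a fixed point.  Since [B] and
  [f] do not vanish identically, each is therefore bounded below somewhere near
  [p] ([lower_bound_in_disc]).
- From a point where [B] is bounded below to a whole disc of tiny radius [d]
  one passes by a Hoelder estimate ([holder_half]); three circles then give a
  lower bound for [f] inside that tiny disc ([lower_bound_in_smaller_disc]).
- At a maximum of [|f|^2 (d^2 - |z - q|^2)^K] over the disc of radius [d], the
  first and second order conditions bound [f'/f] by [4 K / d] and [f''/f] by a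
  multiple of [K^2 / d^2] ([log_derivative_bound]).  The integer [K] is
  about twice the gap between the upper and lower bounds for [log |f|], hence at
  most [exp (C s^-be log (1/s))].

Inserted in the equation at the maximum point this yields
[c s^-n <= C s^-be log (1/s)] for all small [s] ([scale_inequality]), which is
false.  All bounds are written in terms of [x = log (1/s)]. *)

(** * Moduli, exponentials and unit complex numbers *)

Lemma Cmod_components (x y : R) : Cmod (x, y) <= Rabs x + Rabs y.
Proof.
  replace (x, y) with (RtoC x + RtoC y * Ci)%C
    by (unfold RtoC, Ci, Cplus, Cmult; simpl; f_equal; ring).
  eapply Rle_trans; [apply Cmod_triangle|].
  rewrite Cmod_mult, Cmod_Ci, !Cmod_R; lra.
Qed.

Lemma Cmod_components_le (z : C) :
  Rabs (fst z) <= Cmod z /\ Rabs (snd z) <= Cmod z.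
Proof.
  generalize (Rmax_Cmod z) (Rmax_l (Rabs (fst z)) (Rabs (snd z)))
    (Rmax_r (Rabs (fst z)) (Rabs (snd z))); lra.
Qed.

Lemma Cmod_sub_sym (a b : C) : Cmod (a - b) = Cmod (b - a).
Proof. rewrite <- Cmod_opp; f_equal; ring. Qed.

Lemma Cmod_triangle_rev (a b : C) : Cmod a - Cmod b <= Cmod (a - b).
Proof.
  generalize (Cmod_triangle (a - b) b).
  replace (a - b + b)%C with a by ring. lra.
Qed.

Lemma Cmod_sqr (z : C) : Cmod z * Cmod z = fst z * fst z + snd z * snd z.
Proof.
  replace (Cmod z * Cmod z) with (Cmod z ^ 2) by ring.
  rewrite Cmod2_alt; unfold Re, Im; ring.
Qed.

Lemma Cmod_Cconj_mult (z : C) : (Cconj z * z)%C = RtoC (Cmod z * Cmod z).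
Proof.
  rewrite Cmod_sqr; destruct z as [x y].
  unfold Cconj, Cmult, RtoC; simpl; f_equal; ring.
Qed.

Definition Cmod2 (z : C) : R := Cmod z * Cmod z.

Lemma Cmod2_pos (z : C) : 0 <= Cmod2 z.
Proof. unfold Cmod2; generalize (Cmod_ge_0 z); nra. Qed.

Lemma Cmod2_plus (a v : C) :
  Cmod2 (a + v) = Cmod2 a + 2 * Re (Cconj a * v) + Cmod2 v.
Proof. unfold Cmod2; rewrite !Cmod_sqr; destruct a, v; unfold Re; simpl; ring. Qed.

Lemma Cmod2_gt_0 z : z <> RtoC 0 -> 0 < Cmod2 z.
Proof. intros H; apply Cmod_gt_0 in H; unfold Cmod2; nra. Qed.

Lemma ln_Cmod2 z : z <> RtoC 0 -> ln (Cmod2 z) = 2 * ln (Cmod z).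
Proof.
  intros H; apply Cmod_gt_0 in H. unfold Cmod2; rewrite ln_mult by lra; ring.
Qed.

Lemma ln_lt_pos x y : 0 < x -> x < y -> 0 < ln (y / x).
Proof. intros Hx Hy. rewrite ln_div by lra. generalize (ln_increasing _ _ Hx Hy); lra. Qed.

Lemma exp_le (x y : R) : x <= y -> exp x <= exp y.
Proof. intros [H| ->]; [left; apply exp_increasing; assumption|lra]. Qed.

Lemma exp_ge_1 (x : R) : 0 <= x -> 1 <= exp x.
Proof. intros Hx. rewrite <- exp_0 at 1. apply exp_le, Hx. Qed.

Lemma ln_le_minus_1 x : 0 < x -> ln x <= x - 1.
Proof.
  intros Hx. generalize (exp_ineq1_le (ln x)). rewrite exp_ln by assumption. lra.
Qed.

Lemma nat_between (x : R) : 1 <= x -> exists K : nat, (1 <= K)%nat /\ x <= INR K <= x + 1.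
Proof.
  intros Hx. destruct (archimed x) as [H1 H2].
  assert (Hz : (0 <= up x)%Z) by (apply le_IZR; simpl; lra).
  exists (Z.to_nat (up x)). rewrite INR_IZR_INZ, Z2Nat.id by assumption.
  split; [|lra]. apply INR_le. rewrite INR_IZR_INZ, (INR_IZR_INZ (Z.to_nat _)), Z2Nat.id by assumption.
  simpl; lra.
Qed.

Definition cis (t : R) : C := (cos t, sin t).

Lemma cis_plus s t : cis (s + t) = (cis s * cis t)%C.
Proof.
  unfold cis, Cmult; simpl. rewrite cos_plus, sin_plus; f_equal; ring.
Qed.

Lemma Cmod_cis t : Cmod (cis t) = 1.
Proof.
  assert (H := Cmod_sqr (cis t)). unfold cis in H at 3 4 5 6; simpl in H.
  generalize (sin2_cos2 t) (Cmod_ge_0 (cis t)); unfold Rsqr; intros; nra.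
Qed.

Lemma cis_surj u : Cmod u = 1 -> exists t, Rabs t <= PI /\ u = cis t.
Proof.
  intros Hu. assert (H := Cmod_sqr u). rewrite Hu in H.
  destruct u as [x y]; simpl in H.
  assert (Hx : -1 <= x <= 1) by nra.
  assert (Hb := acos_bound x).
  assert (Hs : sin (acos x) = sqrt (1 - x * x)).
  { rewrite sin_acos by assumption. unfold Rsqr; reflexivity. }
  assert (Hy : sqrt (1 - x * x) = Rabs y).
  { replace (1 - x * x) with (y * y) by lra. apply sqrt_Rsqr_abs. }
  destruct (Rle_dec 0 y) as [H0|H0].
  - exists (acos x); split; [rewrite Rabs_pos_eq; lra|].
    unfold cis; rewrite cos_acos, Hs, Hy, Rabs_pos_eq by lra; reflexivity.
  - exists (- acos x); split; [rewrite Rabs_Ropp, Rabs_pos_eq; lra|].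
    unfold cis; rewrite cos_neg, sin_neg, cos_acos, Hs, Hy, Rabs_left1 by lra.
    f_equal; ring.
Qed.

Lemma Rabs_sin_le t : Rabs (sin t) <= Rabs t.
Proof.
  destruct (MVT_gen sin 0 t cos) as [c [_ Hc]].
  - intros x _. apply is_derive_Reals, derivable_pt_lim_sin.
  - intros x _. apply derivable_continuous_pt, derivable_pt_sin.
  - rewrite sin_0, !Rminus_0_r in Hc. rewrite Hc, Rabs_mult.
    assert (Rabs (cos c) <= 1) by (apply Rabs_le; apply COS_bound).
    generalize (Rabs_pos t); nra.
Qed.

Lemma Cmod_cis_minus_1 t : Cmod (cis t - 1) <= Rabs t.
Proof.
  assert (H := Cmod_sqr (cis t - 1)). unfold cis in H at 3 4 5 6; simpl in H.
  assert (Hc : cos t = 1 - 2 * (sin (t / 2) * sin (t / 2))).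
  { replace t with (2 * (t / 2)) at 1 by field. rewrite cos_2a_sin. ring. }
  assert (Hs := sin2_cos2 t). unfold Rsqr in Hs.
  assert (Hq : Cmod (cis t - 1) * Cmod (cis t - 1) = 4 * (sin (t / 2) * sin (t / 2))).
  { rewrite H. nra. }
  assert (Hb := Rabs_sin_le (t / 2)).
  assert (Ht : Rabs (t / 2) = Rabs t / 2).
  { unfold Rdiv; rewrite Rabs_mult, (Rabs_pos_eq (/ 2)) by lra; reflexivity. }
  rewrite Ht in Hb.
  assert (He : sin (t / 2) * sin (t / 2) = Rabs (sin (t / 2)) * Rabs (sin (t / 2))).
  { rewrite <- Rabs_mult, Rabs_pos_eq; nra. }
  rewrite He in Hq. generalize (Rabs_pos (sin (t / 2))) (Rabs_pos t).
  intros. apply Rsqr_incr_0_var; [unfold Rsqr; nra|assumption].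
Qed.

Lemma cis_pow t n : (cis t ^ n)%C = cis (INR n * t).
Proof.
  induction n as [|n IH].
  - simpl. rewrite Rmult_0_l. unfold cis; rewrite cos_0, sin_0; reflexivity.
  - rewrite Cpow_S, IH, <- cis_plus, S_INR. f_equal; ring.
Qed.

Lemma Cmod_Cexp z : Cmod (Cexp z) = exp (Re z).
Proof.
  replace (Cexp z) with (RtoC (exp (Re z)) * cis (Im z))%C.
  - rewrite Cmod_mult, Cmod_cis, Cmod_R, Rabs_pos_eq; [ring|left; apply exp_pos].
  - unfold Cexp, cis, RtoC, Cmult; simpl; f_equal; ring.
Qed.

Lemma exp_pow_nat (x : R) (n : nat) : exp x ^ n = exp (INR n * x).
Proof.
  induction n as [|n IH]; [simpl; rewrite Rmult_0_l, exp_0; reflexivity|].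
  rewrite S_INR. simpl pow. rewrite IH, <- exp_plus. f_equal; ring.
Qed.

(** * Maxima on compact subsets of the plane *)

Definition closed_C (K : C -> Prop) : Prop :=
  forall z, ~ K z -> exists d, 0 < d /\ forall y, Cmod (y - z) < d -> ~ K y.

(** The Lebesgue number property of a compact set, for a covering by discs
whose radii may vary wildly with the centre. *)
Lemma lebesgue_number (K : C -> Prop) (M : R) (e : C -> R) :
  (forall z, K z -> Cmod z <= M) -> closed_C K ->
  (forall z, K z -> 0 < e z) ->
  exists d, 0 < d /\
    forall y, K y -> exists z, K z /\ Cmod (y - z) < e z /\ d <= e z.
Proof.
  intros HM Hcl He.
  assert (Hex : forall z : C, exists d : posreal,
    (K z -> pos d <= e z / 2) /\
    (~ K z -> forall y, Cmod (y - z) < 2 * d -> ~ K y)).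
  { intros z; destruct (classic (K z)) as [Hz|Hz].
    - assert (H : 0 < e z / 2) by (specialize (He z Hz); lra).
      exists (mkposreal _ H); simpl; split; [intros _; lra|tauto].
    - destruct (Hcl z Hz) as [d [Hd Hy]].
      assert (H : 0 < d / 2) by lra.
      exists (mkposreal _ H); simpl; split; [tauto|].
      intros _ y Hyz; apply Hy; lra. }
  pose (dl := fun u v : R => proj1_sig
    (constructive_indefinite_description _ (Hex (u, v)))).
  assert (Hdl : forall u v,
    (K (u, v) -> pos (dl u v) <= e (u, v) / 2) /\
    (~ K (u, v) -> forall y, Cmod (y - (u, v)) < 2 * dl u v -> ~ K y)).
  { intros u v; unfold dl.
    apply (proj2_sig (constructive_indefinite_description _ (Hex (u, v)))). }
  destruct (compactness_value_2d (- M) M (- M) M dl) as [d Hd].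
  exists d; split; [apply cond_pos|].
  intros [y1 y2] Hy.
  destruct (Cmod_components_le (y1, y2)) as [H1 H2]; simpl in H1, H2.
  assert (HyM := HM _ Hy).
  assert (B1 : - M <= y1 <= M).
  { assert (Hb := Rle_trans _ _ _ H1 HyM).
    apply Rabs_le_between in Hb; lra. }
  assert (B2 : - M <= y2 <= M).
  { assert (Hb := Rle_trans _ _ _ H2 HyM).
    apply Rabs_le_between in Hb; lra. }
  destruct (NNPP _ (Hd y1 y2 B1 B2)) as [u [v [_ [_ [Hu [Hv Hdv]]]]]].
  assert (Hdist : Cmod ((y1, y2) - (u, v)) < 2 * dl u v).
  { eapply Rle_lt_trans; [apply Cmod_components|].
    unfold Rminus in Hu, Hv. simpl. lra. }
  destruct (Hdl u v) as [Ha Hb].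
  destruct (classic (K (u, v))) as [Hk|Hk].
  - specialize (Ha Hk); generalize (cond_pos (dl u v)); intros Hp.
    exists (u, v); repeat split; [assumption|lra|lra].
  - exfalso; exact (Hb Hk _ Hdist Hy).
Qed.

(** Only upper semicontinuity along [K] is required, so the functions maximised
below need not be defined sensibly outside their compact domain. *)
Lemma attains_max (K : C -> Prop) (M : R) (g : C -> R) :
  (forall z, K z -> Cmod z <= M) -> closed_C K ->
  (forall z, K z -> forall eps, 0 < eps -> exists d, 0 < d /\
     forall y, K y -> Cmod (y - z) < d -> g y < g z + eps) ->
  (exists z, K z) ->
  exists z, K z /\ forall y, K y -> g y <= g z.
Proof.
  intros HM Hcl Hg [z0 Hz0].
  assert (Hcov : forall e : C -> R, (forall z, K z -> 0 < e z) ->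
    exists d, 0 < d /\ forall y, K y ->
      exists z, K z /\ g y < g z + e z /\ d <= e z).
  { intros e He.
    assert (Hr : forall z, exists r, K z -> 0 < r /\ r <= e z /\
      forall y, K y -> Cmod (y - z) < r -> g y < g z + e z).
    { intros z; destruct (classic (K z)) as [Hz|Hz]; [|exists 0; tauto].
      destruct (Hg z Hz (e z) (He z Hz)) as [d [Hd Hy]].
      exists (Rmin d (e z)); intros _.
      generalize (Rmin_l d (e z)) (Rmin_r d (e z)); intros.
      repeat split; [apply Rmin_pos; auto|lra|].
      intros y Ky Hyz; apply Hy; [assumption|lra]. }
    pose (r := fun z => proj1_sig
      (constructive_indefinite_description _ (Hr z))).
    assert (Hr' : forall z, K z -> 0 < r z /\ r z <= e z /\
      forall y, K y -> Cmod (y - z) < r z -> g y < g z + e z).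
    { intros z; unfold r.
      apply (proj2_sig (constructive_indefinite_description _ (Hr z))). }
    destruct (lebesgue_number K M r HM Hcl) as [d [Hd Hy]].
    { intros z Hz; apply Hr'; assumption. }
    exists d; split; [assumption|].
    intros y Ky; destruct (Hy y Ky) as [z [Kz [Hyz Hdz]]].
    destruct (Hr' z Kz) as [_ [H1 H2]].
    exists z; repeat split; [assumption|apply H2; assumption|lra]. }
  assert (Hbd : exists b, forall y, K y -> g y <= b).
  { destruct (Hcov (fun z => / (1 + Rabs (g z)))) as [d [Hd Hy]].
    { intros z _; apply Rinv_0_lt_compat; generalize (Rabs_pos (g z)); lra. }
    exists (/ d + 1); intros y Ky.
    destruct (Hy y Ky) as [z [_ [H1 H2]]].
    assert (Hp : 0 < 1 + Rabs (g z)) by (generalize (Rabs_pos (g z)); lra).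
    assert (H3 : 1 + Rabs (g z) <= / d).
    { rewrite <- (Rinv_inv (1 + Rabs (g z))).
      apply Rinv_le_contravar; assumption. }
    assert (H4 : / (1 + Rabs (g z)) <= 1).
    { rewrite <- Rinv_1. apply Rinv_le_contravar; [lra|].
      generalize (Rabs_pos (g z)); lra. }
    generalize (Rle_abs (g z)); lra. }
  destruct Hbd as [b Hb].
  destruct (completeness (fun v => exists z, K z /\ v = g z)) as [S [HS1 HS2]].
  { exists b; intros v [z [Kz ->]]; apply Hb; assumption. }
  { exists (g z0), z0; split; [assumption|reflexivity]. }
  assert (HSle : forall z, K z -> g z <= S).
  { intros z Kz; apply HS1; exists z; split; [assumption|reflexivity]. }
  apply NNPP; intros Hno.
  assert (Hlt : forall z, K z -> g z < S).
  { intros z Kz; destruct (Rle_lt_or_eq_dec _ _ (HSle z Kz)) as [H|H];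
      [assumption|].
    exfalso; apply Hno; exists z; split; [assumption|].
    intros y Ky; rewrite H; apply HSle; assumption. }
  destruct (Hcov (fun z => (S - g z) / 2)) as [d [Hd Hy]].
  { intros z Kz; specialize (Hlt z Kz); lra. }
  assert (S <= S - d); [|lra].
  apply HS2; intros v [y [Ky ->]].
  destruct (Hy y Ky) as [z [_ [H1 H2]]]; lra.
Qed.

(** Continuity for the topology that the modulus puts on [C]; the canonical
uniform structure on [C] is that of a product, which unification would choose. *)
Definition continuous_C (g : C -> R) (z : C) : Prop :=
  @continuous (AbsRing_UniformSpace C_AbsRing) R_UniformSpace g z.

Lemma continuous_C_intro (g : C -> R) (z : C) :
  (forall eps, 0 < eps -> exists d, 0 < d /\
    forall y, Cmod (y - z) < d -> Rabs (g y - g z) < eps) ->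
  continuous_C g z.
Proof.
  intros H. apply filterlim_locally; intros eps.
  destruct (H eps (cond_pos eps)) as [d [Hd K]].
  exists (mkposreal d Hd); intros y Hy. apply K. exact Hy.
Qed.

Lemma continuous_C_elim (g : C -> R) (z : C) :
  continuous_C g z ->
  forall eps, 0 < eps -> exists d, 0 < d /\
    forall y, Cmod (y - z) < d -> Rabs (g y - g z) < eps.
Proof.
  intros H eps He.
  destruct (proj1 (filterlim_locally _ _) H (mkposreal eps He)) as [d K].
  exists d; split; [apply cond_pos|]. intros y Hy; apply (K y Hy).
Qed.

Lemma continuous_C_mult f g z : continuous_C f z -> continuous_C g z ->
  continuous_C (fun y => f y * g y) z.
Proof.
  exact (@continuous_mult (AbsRing_UniformSpace C_AbsRing) R_AbsRing f g z).
Qed.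

Lemma continuous_C_plus f g z : continuous_C f z -> continuous_C g z ->
  continuous_C (fun y => f y + g y) z.
Proof.
  exact (@continuous_plus (AbsRing_UniformSpace C_AbsRing) R_AbsRing
    R_NormedModule f g z).
Qed.

Lemma continuous_C_const k z : continuous_C (fun _ => k) z.
Proof.
  exact (@continuous_const (AbsRing_UniformSpace C_AbsRing) R_UniformSpace k z).
Qed.

Lemma continuous_C_comp f (phi : R -> R) z :
  continuous_C f z -> continuity_pt phi (f z) ->
  continuous_C (fun y => phi (f y)) z.
Proof.
  intros Hf Hp. apply continuity_pt_filterlim in Hp.
  exact (@continuous_comp (AbsRing_UniformSpace C_AbsRing) R_UniformSpace
    R_UniformSpace f phi z Hf Hp).
Qed.

Lemma closed_annulus c r1 r3 : closed_C (fun z => r1 <= Cmod (z - c) <= r3).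
Proof.
  intros z Hz. destruct (Rlt_dec (Cmod (z - c)) r1) as [H|H].
  - exists (r1 - Cmod (z - c)); split; [lra|]; intros y Hy [H1 _].
    generalize (Cmod_triangle (y - z) (z - c)).
    replace (y - z + (z - c))%C with (y - c)%C by ring; lra.
  - exists (Cmod (z - c) - r3); split; [apply Rnot_le_lt in H || idtac|].
    + apply Rnot_ge_lt; intros Hn; apply Hz; lra.
    + intros y Hy [_ H1]. generalize (Cmod_triangle (z - y) (y - c)).
      rewrite (Cmod_sub_sym z y).
      replace (z - y + (y - c))%C with (z - c)%C by ring; lra.
Qed.

(** * Second-order jets *)

(** A second-order Taylor expansion with a Peano remainder, the real quadratic
form being split into its harmonic part [Re (q h^2)] and its Laplacian part
[s |h|^2]. *)
Definition real_jet (phi : C -> R) (z p q : C) (s : R) : Prop :=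
  forall eps, 0 < eps -> exists d, 0 < d /\ forall h, Cmod h < d ->
    Rabs (phi (z + h)%C - phi z - Re (p * h) - Re (q * (h * h))
          - s * (Cmod h * Cmod h)) <= eps * (Cmod h * Cmod h).

(** The second-order expansion at a single point is all that is used of
holomorphy; it is available both for power series and for solutions of the
equation, and avoids any discussion of higher derivatives. *)
Definition jet (G : C -> C) (z a b c : C) : Prop :=
  forall eps, 0 < eps -> exists d, 0 < d /\ forall h, Cmod h < d ->
    Cmod (G (z + h) - (a + b * h + c * (h * h)))%C
      <= eps * (Cmod h * Cmod h).

Lemma real_jet_plus phi psi z p q s p' q' s' :
  real_jet phi z p q s -> real_jet psi z p' q' s' ->
  real_jet (fun y => phi y + psi y) z (p + p') (q + q') (s + s').
Proof.
  intros H1 H2 eps He.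
  destruct (H1 (eps / 2)) as [d1 [Hd1 K1]]; [lra|].
  destruct (H2 (eps / 2)) as [d2 [Hd2 K2]]; [lra|].
  exists (Rmin d1 d2); split; [apply Rmin_pos; assumption|].
  intros h Hh.
  specialize (K1 h (Rlt_le_trans _ _ _ Hh (Rmin_l _ _))).
  specialize (K2 h (Rlt_le_trans _ _ _ Hh (Rmin_r _ _))).
  rewrite !Cmult_plus_distr_r, !re_plus.
  match goal with |- Rabs ?x <= _ => match type of K1 with Rabs ?y <= _ =>
    match type of K2 with Rabs ?w <= _ => replace x with (y + w) by ring end end end.
  eapply Rle_trans; [apply Rabs_triang|]; lra.
Qed.

Lemma real_jet_scal k phi z p q s :
  real_jet phi z p q s ->
  real_jet (fun y => k * phi y) z (RtoC k * p) (RtoC k * q) (k * s).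
Proof.
  intros H eps He.
  assert (Hk : 0 < Rabs k + 1) by (generalize (Rabs_pos k); lra).
  destruct (H (eps / (Rabs k + 1))) as [d [Hd K]].
  { apply Rdiv_lt_0_compat; lra. }
  exists d; split; [assumption|]; intros h Hh; specialize (K h Hh).
  rewrite <- !Cmult_assoc, !re_scal_l.
  match goal with |- Rabs ?x <= _ => match type of K with Rabs ?y <= _ =>
    replace x with (k * y) by ring end end.
  rewrite Rabs_mult.
  assert (Hm : 0 <= Cmod h * Cmod h) by (apply Rmult_le_pos; apply Cmod_ge_0).
  apply Rle_trans with
    ((Rabs k + 1) * (eps / (Rabs k + 1) * (Cmod h * Cmod h))).
  - apply Rmult_le_compat; [apply Rabs_pos|apply Rabs_pos|lra|exact K].
  - right; field; lra.
Qed.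

(** The first-order term vanishes by testing [h] in the direction of the
conjugate of [p].  The directions [1], [i], [1 + i], [1 - i] turn the sign of
the quadratic form into bounds for the real and imaginary parts of [q]; this
costs the factor 2. *)
Lemma real_jet_max phi z p q s :
  real_jet phi z p q s ->
  (exists d, 0 < d /\ forall h, Cmod h < d -> phi (z + h)%C <= phi z) ->
  p = RtoC 0 /\ Cmod q <= - 2 * s.
Proof.
  intros HJ [d0 [Hd0 Hmax]].
  assert (Hp : p = RtoC 0).
  { apply NNPP; intros Hp0.
    assert (HP : 0 < Cmod p) by (apply Cmod_gt_0; assumption).
    destruct (HJ 1 Rlt_0_1) as [d1 [Hd1 K]].
    set (c := 1 + Cmod q + Rabs s).
    assert (Hc : 1 <= c)
      by (unfold c; generalize (Cmod_ge_0 q) (Rabs_pos s); lra).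
    (* along [h = t conj p] the linear term is [t |p|^2] and the others are at most
       [c t^2 |p|^2] *)
    set (t := Rmin (Rmin d0 d1 / (2 * Cmod p)) (/ (2 * c))).
    assert (Hdd : 0 < Rmin d0 d1) by (apply Rmin_pos; assumption).
    assert (Ht : 0 < t).
    { apply Rmin_pos; [apply Rdiv_lt_0_compat; lra|].
      apply Rinv_0_lt_compat; lra. }
    assert (Htc : t * c < 1).
    { apply Rle_lt_trans with (/ (2 * c) * c);
        [apply Rmult_le_compat_r; [lra|apply Rmin_r]|].
      replace (/ (2 * c) * c) with (/ 2) by (field; lra); lra. }
    assert (Hh : Cmod (RtoC t * Cconj p) = t * Cmod p).
    { rewrite Cmod_mult, Cmod_conj, Cmod_R, Rabs_pos_eq; lra. }
    assert (Hh0 : t * Cmod p < Rmin d0 d1).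
    { apply Rle_lt_trans with (Rmin d0 d1 / (2 * Cmod p) * Cmod p);
        [apply Rmult_le_compat_r; [lra|apply Rmin_l]|].
      replace (Rmin d0 d1 / (2 * Cmod p) * Cmod p) with (Rmin d0 d1 / 2)
        by (field; lra); lra. }
    set (h := (RtoC t * Cconj p)%C) in *.
    generalize (Rmin_l d0 d1) (Rmin_r d0 d1); intros.
    specialize (K h ltac:(lra)); specialize (Hmax h ltac:(lra)).
    assert (E1 : Re (p * h) = t * (Cmod p * Cmod p)).
    { replace (p * h)%C with (RtoC t * (Cconj p * p))%C by (unfold h; ring).
      rewrite Cmod_Cconj_mult, re_scal_l; reflexivity. }
    assert (E2 : Rabs (Re (q * (h * h))) <= Cmod q * (Cmod h * Cmod h)).
    { eapply Rle_trans; [apply re_le_Cmod|]. rewrite !Cmod_mult; lra. }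
    apply Rabs_le_between in K. apply Rabs_le_between in E2.
    rewrite E1 in K. rewrite Hh in *.
    assert (Hs : s * (t * Cmod p * (t * Cmod p)) >=
      - (Rabs s * (t * Cmod p * (t * Cmod p)))).
    { assert (0 <= t * Cmod p * (t * Cmod p)) by nra.
      assert (- Rabs s <= s) by (generalize (Rabs_maj2 s); lra). nra. }
    assert (Hcc : t * (Cmod p * Cmod p) <= c * (t * Cmod p * (t * Cmod p))).
    { unfold c; lra. }
    assert (0 < t * (Cmod p * Cmod p)) by (apply Rmult_lt_0_compat; nra).
    replace (c * (t * Cmod p * (t * Cmod p))) with
      ((t * c) * (t * (Cmod p * Cmod p))) in Hcc by ring.
    nra. }
  split; [exact Hp|]; subst p.
  assert (Hdir : forall e, 0 < Cmod e ->
    Re (q * (e * e)) + s * (Cmod e * Cmod e) <= 0).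
  { intros e He. apply Rnot_gt_le; intros Hgt.
    set (v := Re (q * (e * e)) + s * (Cmod e * Cmod e)) in *.
    assert (Hee : 0 < Cmod e * Cmod e) by nra.
    destruct (HJ (v / (2 * (Cmod e * Cmod e)))) as [d1 [Hd1 K]].
    { apply Rdiv_lt_0_compat; lra. }
    assert (Hdd : 0 < Rmin d0 d1) by (apply Rmin_pos; assumption).
    set (t := Rmin d0 d1 / (2 * Cmod e)).
    assert (Ht : 0 < t) by (apply Rdiv_lt_0_compat; lra).
    assert (Hh : Cmod (RtoC t * e) = t * Cmod e).
    { rewrite Cmod_mult, Cmod_R, Rabs_pos_eq; lra. }
    assert (Hh0 : t * Cmod e < Rmin d0 d1).
    { replace (t * Cmod e) with (Rmin d0 d1 / 2) by (unfold t; field; lra).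
      lra. }
    generalize (Rmin_l d0 d1) (Rmin_r d0 d1); intros.
    set (h := (RtoC t * e)%C) in *.
    specialize (K h ltac:(lra)); specialize (Hmax h ltac:(lra)).
    replace (q * (h * h))%C with (RtoC (t * t) * (q * (e * e)))%C in K
      by (unfold h; rewrite RtoC_mult; ring).
    rewrite Cmult_0_l, re_scal_l, Hh in K.
    apply Rabs_le_between in K. change (Re 0) with 0 in K.
    replace (v / (2 * (Cmod e * Cmod e)) * (t * Cmod e * (t * Cmod e)))
      with (t * t * v / 2) in K by (field; lra).
    assert (t * t * v > 0) by (apply Rmult_lt_0_compat; nra).
    unfold v in *. nra. }
  destruct q as [q1 q2].
  assert (D1 := Hdir (1, 0)). assert (D2 := Hdir (0, 1)).
  assert (D3 := Hdir (1, 1)). assert (D4 := Hdir (1, -1)).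
  rewrite Cmod_sqr in D1, D2, D3, D4; simpl in D1, D2, D3, D4.
  assert (P : forall z : C, z <> RtoC 0 -> 0 < Cmod z)
    by (intros; apply Cmod_gt_0; assumption).
  assert (N : forall x y : R, x <> 0 \/ y <> 0 -> (x, y) <> RtoC 0).
  { intros x y Hxy Heq; injection Heq; lra. }
  specialize (D1 (P _ (N 1 0 ltac:(lra)))).
  specialize (D2 (P _ (N 0 1 ltac:(lra)))).
  specialize (D3 (P _ (N 1 1 ltac:(lra)))).
  specialize (D4 (P _ (N 1 (-1) ltac:(lra)))).
  eapply Rle_trans; [apply Cmod_components|].
  assert (Rabs q1 <= - s) by (apply Rabs_le; lra).
  assert (Rabs q2 <= - s) by (apply Rabs_le; lra).
  lra.
Qed.

Lemma ln_one_plus_taylor (y : R) :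
  Rabs y <= / 2 -> Rabs (ln (1 + y) - y + y * y / 2) <= 2 * (Rabs y * Rabs y * Rabs y).
Proof.
  intros Hy.
  assert (Hb := proj1 (Rabs_le_between _ _) Hy).
  set (g := fun x => ln (1 + x) - x + x * x / 2).
  assert (Hd : forall x, Rmin 0 y <= x <= Rmax 0 y ->
    is_derive g x (x * x / (1 + x))).
  { intros x Hx.
    assert (- / 2 <= x <= / 2).
    { unfold Rmin, Rmax in Hx; destruct (Rle_dec 0 y); lra. }
    unfold g; auto_derive; [lra|field; lra]. }
  destruct (MVT_gen g 0 y (fun x => x * x / (1 + x))) as [c [Hc Heq]].
  { intros x Hx; apply Hd; lra. }
  { intros x Hx. apply derivable_continuous_pt.
    exists (x * x / (1 + x)). apply is_derive_Reals; apply Hd; assumption. }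
  replace (g 0) with 0 in Heq by (unfold g; rewrite Rplus_0_r, ln_1; lra).
  change (Rabs (g y) <= 2 * (Rabs y * Rabs y * Rabs y)).
  replace (g y) with (c * c / (1 + c) * (y - 0)) by lra.
  assert (Hc2 : - / 2 <= c <= / 2 /\ Rabs c <= Rabs y /\ 0 <= c * y).
  { unfold Rmin, Rmax in Hc; destruct (Rle_dec 0 y).
    - rewrite !Rabs_pos_eq by lra; repeat split; try lra; nra.
    - rewrite !Rabs_left1 by lra; repeat split; try lra; nra. }
  destruct Hc2 as [Hc2 [Hc3 Hc4]].
  rewrite Rminus_0_r.
  assert (Hpos : 0 <= Rabs y) by apply Rabs_pos.
  unfold Rdiv. rewrite !Rabs_mult.
  rewrite (Rabs_pos_eq (/ (1 + c))) by (left; apply Rinv_0_lt_compat; lra).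
  assert (Hi : / (1 + c) <= 2).
  { rewrite <- (Rinv_inv 2). apply Rinv_le_contravar; lra. }
  assert (Hi0 : 0 < / (1 + c)) by (apply Rinv_0_lt_compat; lra).
  assert (0 <= Rabs c) by apply Rabs_pos.
  replace (2 * (Rabs y * Rabs y * Rabs y)) with
    (Rabs y * Rabs y * 2 * Rabs y) by ring.
  apply Rmult_le_compat_r; [lra|].
  apply Rmult_le_compat; nra.
Qed.

Lemma Re_sqr (x : C) : Re x * Re x = (Cmod x * Cmod x + Re (x * x)) / 2.
Proof. rewrite Cmod_sqr; destruct x; unfold Re; simpl; field. Qed.

(** The square of the linear term, [Re (p h) ^ 2], splits as
[|p|^2 |h|^2 / 2 + Re (p^2 h^2) / 2]; this explains the corrections to [q] and
to [s]. *)
Lemma real_jet_ln psi z p q s :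
  real_jet psi z p q s -> 0 < psi z ->
  real_jet (fun y => ln (psi y)) z (RtoC (/ psi z) * p)
    (RtoC (/ psi z) * q + RtoC (- / (4 * (psi z * psi z))) * (p * p))
    (s / psi z - Cmod p * Cmod p / (4 * (psi z * psi z))).
Proof.
  intros HJ Hpos eps He.
  set (w := psi z) in *.
  set (Q := Cmod q + Rabs s + 1).
  assert (HQ : 1 <= Q)
    by (unfold Q; generalize (Cmod_ge_0 q) (Rabs_pos s); lra).
  set (M := (Cmod p + Q) / w).
  assert (HM0 : Q / w <= M).
  { unfold M, Rdiv; apply Rmult_le_compat_r;
      [left; apply Rinv_0_lt_compat; lra|generalize (Cmod_ge_0 p); lra]. }
  assert (HQw : 0 < Q / w) by (apply Rdiv_lt_0_compat; lra).
  assert (HMp : 0 < M) by lra.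
  set (c := 2 * (M * M * M) + M * M).
  assert (Hc : 0 < c).
  { unfold c. assert (0 < M * M) by nra. assert (0 < M * M * M) by nra. lra. }
  assert (Heps1 : 0 < Rmin 1 (eps * w / 2)).
  { apply Rmin_pos; [lra|]. nra. }
  destruct (HJ _ Heps1) as [d [Hd K]].
  set (d' := Rmin (Rmin d 1) (Rmin (/ (2 * M)) (eps / (2 * c)))).
  exists d'; split.
  { repeat apply Rmin_pos; try lra; [apply Rinv_0_lt_compat; lra|].
    apply Rdiv_lt_0_compat; lra. }
  intros h Hh.
  assert (Hm := Cmod_ge_0 h).
  assert (Hh1 : Cmod h < d) by
    (eapply Rlt_le_trans; [exact Hh|]; eapply Rle_trans;
       [apply Rmin_l|apply Rmin_l]).
  assert (Hh2 : Cmod h < 1) by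
    (eapply Rlt_le_trans; [exact Hh|]; eapply Rle_trans;
       [apply Rmin_l|apply Rmin_r]).
  assert (Hh3 : Cmod h < / (2 * M)) by
    (eapply Rlt_le_trans; [exact Hh|]; eapply Rle_trans;
       [apply Rmin_r|apply Rmin_l]).
  assert (Hh4 : Cmod h < eps / (2 * c)) by
    (eapply Rlt_le_trans; [exact Hh|]; eapply Rle_trans;
       [apply Rmin_r|apply Rmin_r]).
  specialize (K h Hh1).
  set (x := Cmod h) in *.
  set (L := Re (p * h)) in *.
  set (W := Re (q * (h * h)) + s * (x * x)).
  set (Rm := psi (z + h)%C - w - L - Re (q * (h * h)) - s * (x * x)) in *.
  assert (HR1 : Rabs Rm <= x * x).
  { eapply Rle_trans; [exact K|].
    generalize (Rmin_l 1 (eps * w / 2)); intros.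
    assert (0 <= x * x) by nra. nra. }
  assert (HR2 : Rabs Rm <= eps * w / 2 * (x * x)).
  { eapply Rle_trans; [exact K|].
    generalize (Rmin_r 1 (eps * w / 2)); intros.
    assert (0 <= x * x) by nra. nra. }
  assert (HL : Rabs L <= Cmod p * x).
  { eapply Rle_trans; [apply re_le_Cmod|]. rewrite Cmod_mult; unfold x; lra. }
  assert (HW : Rabs W <= (Cmod q + Rabs s) * (x * x)).
  { unfold W. eapply Rle_trans; [apply Rabs_triang|].
    assert (Rabs (Re (q * (h * h))) <= Cmod q * (x * x)).
    { eapply Rle_trans; [apply re_le_Cmod|]. rewrite !Cmod_mult; unfold x; lra. }
    rewrite (Rabs_mult s), (Rabs_pos_eq (x * x)) by nra. lra. }
  set (y := (psi (z + h)%C - w) / w).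
  assert (Hy1 : y - L / w = (W + Rm) / w) by (unfold y, W, Rm; field; lra).
  assert (Hy2 : Rabs (y - L / w) <= M * (x * x)).
  { rewrite Hy1. unfold Rdiv; rewrite Rabs_mult.
    rewrite (Rabs_pos_eq (/ w)) by (left; apply Rinv_0_lt_compat; lra).
    apply Rle_trans with (Q * (x * x) * / w).
    - apply Rmult_le_compat_r; [left; apply Rinv_0_lt_compat; lra|].
      eapply Rle_trans; [apply Rabs_triang|]. unfold Q; lra.
    - replace (Q * (x * x) * / w) with (Q / w * (x * x)) by (unfold Rdiv; ring).
      apply Rmult_le_compat_r; nra. }
  assert (HLw : Rabs (L / w) <= Cmod p / w * x).
  { unfold Rdiv; rewrite Rabs_mult.
    rewrite (Rabs_pos_eq (/ w)) by (left; apply Rinv_0_lt_compat; lra).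
    replace (Cmod p * / w * x) with (Cmod p * x * / w) by ring.
    apply Rmult_le_compat_r; [left; apply Rinv_0_lt_compat; lra|exact HL]. }
  assert (Hyx : Rabs y <= M * x).
  { replace y with ((y - L / w) + L / w) by ring.
    eapply Rle_trans; [apply Rabs_triang|].
    assert (Rabs (y - L / w) <= Q / w * x).
    { rewrite Hy1. unfold Rdiv; rewrite Rabs_mult.
      rewrite (Rabs_pos_eq (/ w)) by (left; apply Rinv_0_lt_compat; lra).
      replace (Q * / w * x) with (Q * x * / w) by ring.
      apply Rmult_le_compat_r; [left; apply Rinv_0_lt_compat; lra|].
      eapply Rle_trans; [apply Rabs_triang|].
      assert (x * x <= x) by nra.
      assert ((Cmod q + Rabs s) * (x * x) <= (Cmod q + Rabs s) * x).
      { apply Rmult_le_compat_l; [|assumption].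
        generalize (Cmod_ge_0 q) (Rabs_pos s); lra. }
      unfold Q; lra. }
    replace (M * x) with (Q / w * x + Cmod p / w * x) by (unfold M; field; lra).
    lra. }
  assert (Hyh : Rabs y <= / 2).
  { apply Rle_trans with (M * x); [assumption|].
    apply Rle_trans with (M * / (2 * M)); [apply Rmult_le_compat_l; lra|].
    right; field; lra. }
  assert (HE := ln_one_plus_taylor y Hyh).
  assert (Hln : ln (psi (z + h)%C) = ln w + ln (1 + y)).
  { rewrite <- ln_mult; [f_equal; unfold y; field; lra|lra|].
    apply Rabs_le_between in Hyh; lra. }
  rewrite Cmult_plus_distr_r, re_plus, <- !Cmult_assoc, !re_scal_l.
  change (psi z) with w. rewrite Hln.
  assert (HL2 : Re (p * (p * (h * h))) = 2 * (L * L) - Cmod p * Cmod p * (x * x)).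
  { replace (p * (p * (h * h)))%C with ((p * h) * (p * h))%C by ring.
    assert (HH := Re_sqr (p * h)).
    rewrite Cmod_mult in HH. fold x in HH. fold L in HH. lra. }
  rewrite HL2. fold L.
  match goal with |- Rabs ?u <= _ => replace u with
    ((ln (1 + y) - y + y * y / 2) + (Rm / w - (y - L / w) * (y + L / w) / 2))
  end.
  2:{ replace (Rm / w) with (y - L / w - W / w) by (rewrite Hy1; field; lra).
      unfold W. field. lra. }
  assert (T1 : Rabs (Rm / w) <= eps / 2 * (x * x)).
  { unfold Rdiv at 1; rewrite Rabs_mult.
    rewrite (Rabs_pos_eq (/ w)) by (left; apply Rinv_0_lt_compat; lra).
    apply Rle_trans with (eps * w / 2 * (x * x) * / w).
    - apply Rmult_le_compat_r; [left; apply Rinv_0_lt_compat; lra|assumption].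
    - right; field; lra. }
  assert (T2 : Rabs ((y - L / w) * (y + L / w) / 2) <= M * M * (x * x * x)).
  { change (Rabs ((y - L / w) * (y + L / w) * / 2) <= M * M * (x * x * x)).
    rewrite 2!Rabs_mult, (Rabs_pos_eq (/ 2)) by lra.
    assert (Rabs (y + L / w) <= 2 * (M * x)).
    { eapply Rle_trans; [apply Rabs_triang|].
      assert (Cmod p / w * x <= M * x).
      { apply Rmult_le_compat_r; [assumption|].
        unfold M, Rdiv; apply Rmult_le_compat_r;
          [left; apply Rinv_0_lt_compat; lra|lra]. }
      lra. }
    apply Rle_trans with (M * (x * x) * (2 * (M * x)) * / 2).
    - apply Rmult_le_compat_r; [lra|].
      apply Rmult_le_compat; try apply Rabs_pos; assumption.
    - right; field. }
  assert (T3 : 2 * (Rabs y * Rabs y * Rabs y) <= 2 * (M * M * M) * (x * x * x)).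
  { assert (0 <= Rabs y) by apply Rabs_pos.
    replace (2 * (M * M * M) * (x * x * x)) with
      (2 * ((M * x) * (M * x) * (M * x))) by ring.
    apply Rmult_le_compat_l; [lra|].
    repeat apply Rmult_le_compat; nra. }
  assert (T4 : c * (x * x * x) <= eps / 2 * (x * x)).
  { replace (c * (x * x * x)) with (c * x * (x * x)) by ring.
    apply Rmult_le_compat_r; [nra|].
    apply Rle_trans with (c * (eps / (2 * c)));
      [apply Rmult_le_compat_l; lra|right; field; lra]. }
  unfold c in T4.
  eapply Rle_trans; [apply Rabs_triang|].
  assert (T5 := Rabs_triang (Rm / w) (- ((y - L / w) * (y + L / w) / 2))).
  rewrite Rabs_Ropp in T5. unfold Rminus in *. lra.
Qed.

Lemma real_jet_Cmod2_center (k e : R) (c z : C) :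
  real_jet (fun y => k + e * Cmod2 (y - c)) z
    (RtoC (2 * e) * Cconj (z - c)) (RtoC 0) e.
Proof.
  intros eps He; exists 1; split; [lra|]; intros h _.
  replace (z + h - c)%C with ((z - c) + h)%C by ring.
  rewrite Cmod2_plus, Cmult_0_l, <- Cmult_assoc, re_scal_l.
  change (Re 0) with 0. unfold Cmod2 at 2.
  match goal with |- Rabs ?x <= _ => replace x with 0 by ring end.
  rewrite Rabs_R0. generalize (Cmod_ge_0 h); nra.
Qed.

Lemma jet_value G z a b c : jet G z a b c -> G z = a.
Proof.
  intros H; destruct (H 1 Rlt_0_1) as [d [Hd K]].
  specialize (K (RtoC 0)). rewrite Cmod_0 in K. specialize (K Hd).
  replace (G (z + 0) - (a + b * 0 + c * (0 * 0)))%C with (G z - a)%C in K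
    by (rewrite Cplus_0_r; ring).
  assert (E : Cmod (G z - a) = 0) by (generalize (Cmod_ge_0 (G z - a)); lra).
  apply Cmod_eq_0 in E.
  replace (G z) with (G z - a + a)%C by ring. rewrite E; ring.
Qed.

Lemma real_jet_Cmod2 G z a b c :
  jet G z a b c ->
  real_jet (fun y => Cmod2 (G y)) z
    (RtoC 2 * (Cconj a * b)) (RtoC 2 * (Cconj a * c)) (Cmod b * Cmod b).
Proof.
  intros HJ eps He.
  assert (Ea := jet_value _ _ _ _ _ HJ).
  set (A := Cmod a + 1).
  assert (HA : 1 <= A) by (unfold A; generalize (Cmod_ge_0 a); lra).
  set (N := (Cmod c + 1) * (2 * Cmod b + (Cmod c + 1))).
  assert (HN : 1 <= N).
  { unfold N; generalize (Cmod_ge_0 b) (Cmod_ge_0 c); intros; nra. }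
  assert (He1 : 0 < Rmin 1 (eps / (4 * A))).
  { apply Rmin_pos; [lra|apply Rdiv_lt_0_compat; lra]. }
  destruct (HJ _ He1) as [d [Hd K]].
  exists (Rmin d (Rmin 1 (eps / (2 * N)))); split.
  { repeat apply Rmin_pos; try lra; apply Rdiv_lt_0_compat; lra. }
  intros h Hh.
  assert (Hh1 : Cmod h < d) by (eapply Rlt_le_trans; [exact Hh|apply Rmin_l]).
  assert (Hh2 : Cmod h < 1) by (eapply Rlt_le_trans;
    [exact Hh|eapply Rle_trans; [apply Rmin_r|apply Rmin_l]]).
  assert (Hh3 : Cmod h < eps / (2 * N)) by (eapply Rlt_le_trans;
    [exact Hh|eapply Rle_trans; [apply Rmin_r|apply Rmin_r]]).
  specialize (K h Hh1). assert (Hx := Cmod_ge_0 h).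
  set (r := (G (z + h) - (a + b * h + c * (h * h)))%C) in *.
  set (x := Cmod h) in *.
  assert (Hr1 : Cmod r <= x * x).
  { eapply Rle_trans; [exact K|]. generalize (Rmin_l 1 (eps / (4 * A))).
    assert (0 <= x * x) by nra. intros; nra. }
  assert (Hr2 : Cmod r <= eps / (4 * A) * (x * x)).
  { eapply Rle_trans; [exact K|]. apply Rmult_le_compat_r; [nra|apply Rmin_r]. }
  set (e := (c * (h * h) + r)%C).
  assert (HG : G (z + h)%C = (a + (b * h + e))%C) by (unfold e, r; ring).
  assert (Hed : Cmod e <= (Cmod c + 1) * (x * x)).
  { unfold e; eapply Rle_trans; [apply Cmod_triangle|].
    rewrite !Cmod_mult; fold x; lra. }
  rewrite HG, Ea, Cmod2_plus, (Cmod2_plus (b * h) e).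
  assert (Ebh : Cmod2 (b * h) = Cmod b * Cmod b * (x * x)).
  { unfold Cmod2; rewrite Cmod_mult; unfold x; ring. }
  rewrite Ebh.
  replace (Cconj a * (b * h + e))%C with
    (Cconj a * b * h + Cconj a * c * (h * h) + Cconj a * r)%C
    by (unfold e; ring).
  rewrite !re_plus, <- (Cmult_assoc (RtoC 2)), <- (Cmult_assoc (RtoC 2)), !re_scal_l.
  match goal with |- Rabs ?u <= _ => replace u with
   (2 * Re (Cconj a * r) + (2 * Re (Cconj (b * h) * e) + Cmod2 e)) by ring end.
  eapply Rle_trans; [apply Rabs_triang|].
  assert (T1 : Rabs (2 * Re (Cconj a * r)) <= eps / 2 * (x * x)).
  { rewrite Rabs_mult, (Rabs_pos_eq 2) by lra.
    assert (Rabs (Re (Cconj a * r)) <= A * (eps / (4 * A) * (x * x))).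
    { eapply Rle_trans; [apply re_le_Cmod|].
      rewrite Cmod_mult, Cmod_conj. apply Rmult_le_compat;
        try apply Cmod_ge_0; [unfold A; lra|assumption]. }
    replace (A * (eps / (4 * A) * (x * x))) with (eps / 4 * (x * x)) in H
      by (field; lra). lra. }
  assert (T2 : Rabs (2 * Re (Cconj (b * h) * e) + Cmod2 e) <= N * x * (x * x)).
  { eapply Rle_trans; [apply Rabs_triang|].
    rewrite Rabs_mult, (Rabs_pos_eq 2), (Rabs_pos_eq (Cmod2 e))
      by (try apply Cmod2_pos; lra).
    assert (Rabs (Re (Cconj (b * h) * e)) <= Cmod b * x * ((Cmod c + 1) * (x * x))).
    { eapply Rle_trans; [apply re_le_Cmod|].
      rewrite Cmod_mult, Cmod_conj, Cmod_mult. fold x.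
      apply Rmult_le_compat_l; [|assumption].
      generalize (Cmod_ge_0 b); nra. }
    assert (Cmod2 e <= (Cmod c + 1) * (x * x) * ((Cmod c + 1) * x)).
    { unfold Cmod2. apply Rmult_le_compat; try apply Cmod_ge_0; [assumption|].
      eapply Rle_trans; [exact Hed|]. apply Rmult_le_compat_l;
        [generalize (Cmod_ge_0 c); lra|nra]. }
    unfold N. lra. }
  assert (T3 : N * x * (x * x) <= eps / 2 * (x * x)).
  { apply Rmult_le_compat_r; [nra|].
    apply Rle_trans with (N * (eps / (2 * N)));
      [apply Rmult_le_compat_l; lra|right; field; lra]. }
  lra.
Qed.

(** The Laplacian part cancels: [ln |G|^2] is harmonic where [G] does not
vanish. *)
Lemma real_jet_ln_Cmod2 G z a b c :
  jet G z a b c -> a <> RtoC 0 ->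
  real_jet (fun y => ln (Cmod2 (G y))) z
    (RtoC 2 * (b / a)) (RtoC 2 * (c / a) - (b / a) * (b / a)) 0.
Proof.
  intros HJ Ha. assert (Ea := jet_value _ _ _ _ _ HJ).
  assert (Hm : 0 < Cmod a) by (apply Cmod_gt_0; assumption).
  assert (Hpos : 0 < Cmod2 (G z)) by (rewrite Ea; unfold Cmod2; nra).
  assert (HR := real_jet_ln _ _ _ _ _ (real_jet_Cmod2 _ _ _ _ _ HJ) Hpos).
  cbv beta in HR. rewrite Ea in HR. change (Cmod2 a) with (Cmod a * Cmod a) in HR.
  assert (Hca : Cconj a <> RtoC 0).
  { intros H0. apply Ha. rewrite <- (Cconj_conj a), H0.
    unfold Cconj, RtoC; simpl; f_equal; ring. }
  assert (Hi : RtoC (/ (Cmod a * Cmod a)) = (/ (Cconj a * a))%C).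
  { rewrite Cmod_Cconj_mult, RtoC_inv; [reflexivity|nra]. }
  assert (Hj : RtoC (- / (4 * (Cmod a * Cmod a * (Cmod a * Cmod a))))
    = (- (/ (RtoC 4 * ((Cconj a * a) * (Cconj a * a)))))%C).
  { rewrite Cmod_Cconj_mult, <- !RtoC_mult, <- RtoC_inv, <- RtoC_opp;
      [reflexivity|].
    assert (0 < Cmod a * Cmod a) by nra. nra. }
  rewrite Hi, Hj in HR.
  replace (RtoC 2 * (b / a))%C with
    (/ (Cconj a * a) * (RtoC 2 * (Cconj a * b)))%C by (field; auto).
  replace (RtoC 2 * (c / a) - b / a * (b / a))%C with
    (/ (Cconj a * a) * (RtoC 2 * (Cconj a * c)) +
     - (/ (RtoC 4 * ((Cconj a * a) * (Cconj a * a)))) *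
      (RtoC 2 * (Cconj a * b) * (RtoC 2 * (Cconj a * b))))%C.
  2:{ field; auto. }
  match type of HR with real_jet _ _ _ _ ?s => replace 0 with s end; [exact HR|].
  rewrite !Cmod_mult, Cmod_conj, Cmod_R, (Rabs_pos_eq 2) by lra. field. lra.
Qed.

Definition has_jet (G : C -> C) (z : C) : Prop := exists a b c, jet G z a b c.

Lemma jet_lipschitz G z : has_jet G z ->
  exists L d, 0 < L /\ 0 < d /\
    forall y, Cmod (y - z) < d -> Cmod (G y - G z) <= L * Cmod (y - z).
Proof.
  intros [a [b [c HJ]]]. assert (Ea := jet_value _ _ _ _ _ HJ).
  destruct (HJ 1 Rlt_0_1) as [d [Hd K]].
  exists (Cmod b + Cmod c + 1), (Rmin d 1); repeat split.
  - generalize (Cmod_ge_0 b) (Cmod_ge_0 c); lra.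
  - apply Rmin_pos; lra.
  - intros y Hy. set (h := (y - z)%C) in *.
    assert (Hh1 : Cmod h < d) by (eapply Rlt_le_trans; [exact Hy|apply Rmin_l]).
    assert (Hh2 : Cmod h < 1) by (eapply Rlt_le_trans; [exact Hy|apply Rmin_r]).
    specialize (K h Hh1). replace (z + h)%C with y in K by (unfold h; ring).
    set (r := (G y - (a + b * h + c * (h * h)))%C) in *.
    replace (G y - G z)%C with (r + (b * h + c * (h * h)))%C
      by (unfold r; rewrite Ea; ring).
    assert (Hx := Cmod_ge_0 h).
    assert (H1 := Cmod_triangle r (b * h + c * (h * h))).
    assert (H2 := Cmod_triangle (b * h) (c * (h * h))).
    rewrite !Cmod_mult in H2.
    assert (Cmod h * Cmod h <= Cmod h) by nra.
    assert (Cmod c * (Cmod h * Cmod h) <= Cmod c * Cmod h)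
      by (apply Rmult_le_compat_l; [apply Cmod_ge_0|assumption]).
    lra.
Qed.

Lemma lipschitz_continuous_Cmod2 (G : C -> C) (z : C) :
  (exists L d, 0 < L /\ 0 < d /\
    forall y, Cmod (y - z) < d -> Cmod (G y - G z) <= L * Cmod (y - z)) ->
  continuous_C (fun y => Cmod2 (G y)) z.
Proof.
  intros [L [d [HL [Hd K]]]].
  assert (Hc : continuous_C (fun y => Cmod (G y)) z).
  { apply continuous_C_intro; intros eps He.
    exists (Rmin d (eps / L)); split.
    { apply Rmin_pos; [assumption|apply Rdiv_lt_0_compat; lra]. }
    intros y Hy.
    assert (H1 := Rlt_le_trans _ _ _ Hy (Rmin_l _ _)).
    assert (H2 := Rlt_le_trans _ _ _ Hy (Rmin_r _ _)).
    assert (H3 : Cmod (G y - G z) < eps).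
    { eapply Rle_lt_trans; [exact (K y H1)|].
      apply Rlt_le_trans with (L * (eps / L));
        [apply Rmult_lt_compat_l; lra|right; field; lra]. }
    eapply Rle_lt_trans; [|exact H3].
    apply Rabs_le. generalize (Cmod_triangle_rev (G y) (G z))
      (Cmod_triangle_rev (G z) (G y)). rewrite (Cmod_sub_sym (G z)). lra. }
  exact (continuous_C_mult _ _ _ Hc Hc).
Qed.

Lemma has_jet_continuous_Cmod2 G z :
  has_jet G z -> continuous_C (fun y => Cmod2 (G y)) z.
Proof. intros HJ; apply lipschitz_continuous_Cmod2, jet_lipschitz, HJ. Qed.

Lemma bounded_on_circle (G : C -> C) (r : R) :
  (forall z, Cmod z = r -> continuous_C (fun y => Cmod2 (G y)) z) ->
  exists M, 0 < M /\ forall z, Cmod z = r -> Cmod (G z) <= M.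
Proof.
  intros HG.
  destruct (classic (exists z, Cmod z = r)) as [[z0 Hz0]|Hno].
  2:{ exists 1; split; [lra|]; intros z Hz; exfalso; apply Hno; exists z; exact Hz. }
  assert (E0 : forall z, Cmod (z - 0) = Cmod z) by (intros; f_equal; ring).
  destruct (attains_max (fun z => r <= Cmod (z - 0) <= r) r
    (fun y => Cmod2 (G y))) as [m [_ Hm]].
  - intros z; rewrite E0; lra.
  - apply closed_annulus.
  - intros z Hz eps He. rewrite E0 in Hz.
    destruct (continuous_C_elim _ _ (HG z ltac:(lra)) eps He) as [d [Hd K]].
    exists d; split; [assumption|]; intros y _ Hy.
    specialize (K y Hy). apply Rabs_lt_between in K; lra.
  - exists z0; rewrite E0; lra.
  - exists (Cmod (G m) + 1); split; [generalize (Cmod_ge_0 (G m)); lra|].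
    intros z Hz. specialize (Hm z). rewrite E0 in Hm. specialize (Hm ltac:(lra)).
    unfold Cmod2 in Hm.
    assert (Cmod (G z) <= Cmod (G m)); [|lra].
    apply Rsqr_incr_0_var; [exact Hm|apply Cmod_ge_0].
Qed.

(** * The maximum principle on annuli *)

Lemma jet_translate c z : jet (fun y => (y - c)%C) z (z - c) 1 0.
Proof.
  intros eps He; exists 1; split; [lra|]; intros h _.
  replace (z + h - c - (z - c + 1 * h + 0 * (h * h)))%C with (RtoC 0) by ring.
  rewrite Cmod_0. generalize (Cmod_ge_0 h); nra.
Qed.

Lemma continuous_C_Cmod2_translate c z : continuous_C (fun y => Cmod2 (y - c)) z.
Proof.
  apply has_jet_continuous_Cmod2; do 3 eexists; apply jet_translate.
Qed.

(** At such a maximum the logarithm of the weighted function would have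
Laplacian part [eps > 0], the two logarithmic terms being harmonic. *)
Lemma no_weighted_interior_max G z al eps c d :
  has_jet G z -> G z <> RtoC 0 -> z <> c -> 0 < eps -> 0 < d ->
  (forall y, Cmod (y - z) < d ->
     Cmod2 (G y) * exp (al * ln (Cmod2 (y - c)) + eps * Cmod2 (y - c)) <=
     Cmod2 (G z) * exp (al * ln (Cmod2 (z - c)) + eps * Cmod2 (z - c))) ->
  False.
Proof.
  intros HG HGz Hzc He Hd Hmax.
  assert (HG2 := Cmod2_gt_0 _ HGz).
  destruct (continuous_C_elim _ _ (has_jet_continuous_Cmod2 _ _ HG) _ HG2)
    as [d1 [Hd1 K1]].
  destruct HG as [a [b [c2 HJ]]].
  assert (Ea := jet_value _ _ _ _ _ HJ).
  assert (J1 := real_jet_ln_Cmod2 _ _ _ _ _ HJ ltac:(rewrite <- Ea; exact HGz)).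
  assert (Hzc' : (z - c)%C <> RtoC 0).
  { intros H; apply Hzc. replace z with (z - c + c)%C by ring. rewrite H; ring. }
  assert (J2 := real_jet_ln_Cmod2 _ _ _ _ _ (jet_translate c z) Hzc').
  assert (J3 := real_jet_Cmod2_center 0 eps c z).
  assert (J := real_jet_plus _ _ _ _ _ _ _ _ _
    (real_jet_plus _ _ _ _ _ _ _ _ _ J1 (real_jet_scal al _ _ _ _ _ J2)) J3).
  apply real_jet_max in J.
  - destruct J as [_ J]. rewrite Rmult_0_r, !Rplus_0_l in J.
    match type of J with Cmod ?q <= _ => generalize (Cmod_ge_0 q) end. lra.
  - exists (Rmin d d1); split; [apply Rmin_pos; assumption|].
    intros h Hh.
    assert (Eh : (z + h - z)%C = h) by ring.
    assert (Hh1 : Cmod (z + h - z) < d)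
      by (rewrite Eh; eapply Rlt_le_trans; [exact Hh|apply Rmin_l]).
    assert (Hh2 : Cmod (z + h - z) < d1)
      by (rewrite Eh; eapply Rlt_le_trans; [exact Hh|apply Rmin_r]).
    specialize (Hmax _ Hh1). specialize (K1 _ Hh2).
    apply Rabs_lt_between in K1.
    set (w := (z + h)%C) in *.
    assert (Hw : 0 < Cmod2 (G w)) by lra.
    apply ln_le in Hmax; [|apply Rmult_lt_0_compat; [assumption|apply exp_pos]].
    rewrite !ln_mult, !ln_exp in Hmax by (assumption || apply exp_pos). lra.
Qed.

(** Interior maxima are excluded after multiplication by [exp (eps |z - c|^2)],
and [eps] then tends to 0.  The weight [exp (al * ln (Cmod2 (z - c)))] is
[|z - c| ^ (2 al)] with a real exponent. *)
Lemma annulus_max G c r1 r3 al M :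
  0 < r1 -> r1 <= r3 ->
  (forall z, r1 <= Cmod (z - c) <= r3 -> has_jet G z) ->
  (forall z, Cmod (z - c) = r1 \/ Cmod (z - c) = r3 ->
     Cmod2 (G z) * exp (al * ln (Cmod2 (z - c))) <= M) ->
  forall z, r1 <= Cmod (z - c) <= r3 ->
     Cmod2 (G z) * exp (al * ln (Cmod2 (z - c))) <= M.
Proof.
  intros Hr1 Hr13 HG Hbd z Hz.
  assert (Heps : forall eps, 0 < eps ->
    Cmod2 (G z) * exp (al * ln (Cmod2 (z - c))) <= M * exp (eps * (r3 * r3))).
  { intros eps He.
    set (g := fun y => Cmod2 (G y) *
      exp (al * ln (Cmod2 (y - c)) + eps * Cmod2 (y - c))).
    assert (Hne : forall y, r1 <= Cmod (y - c) <= r3 -> (y - c)%C <> RtoC 0).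
    { intros y Hy H0. rewrite H0, Cmod_0 in Hy; lra. }
    assert (Hsq : forall y, r1 <= Cmod (y - c) <= r3 -> Cmod2 (y - c) <= r3 * r3).
    { intros y Hy; unfold Cmod2. apply Rmult_le_compat; lra. }
    destruct (attains_max (fun y => r1 <= Cmod (y - c) <= r3) (r3 + Cmod c) g)
      as [m [Hm Hmax]].
    - intros y Hy. generalize (Cmod_triangle (y - c) c).
      replace (y - c + c)%C with y by ring. lra.
    - apply closed_annulus.
    - intros y Hy e He'.
      assert (Hcont : continuous_C g y).
      { apply continuous_C_mult; [apply has_jet_continuous_Cmod2, HG, Hy|].
        apply (continuous_C_comp
          (fun y => al * ln (Cmod2 (y - c)) + eps * Cmod2 (y - c)) exp);
          [|apply derivable_continuous_pt, derivable_pt_exp].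
        apply continuous_C_plus; apply continuous_C_mult;
          try apply continuous_C_const.
        - apply (continuous_C_comp (fun y => Cmod2 (y - c)) ln);
            [apply continuous_C_Cmod2_translate|].
          apply derivable_continuous_pt; exists (/ Cmod2 (y - c)).
          apply derivable_pt_lim_ln.
          apply Cmod2_gt_0, Hne, Hy.
        - apply continuous_C_Cmod2_translate. }
      destruct (continuous_C_elim _ _ Hcont e He') as [d [Hd K]].
      exists d; split; [assumption|]; intros y' _ Hy'.
      specialize (K y' Hy'); apply Rabs_lt_between in K; lra.
    - exists z; exact Hz.
    - assert (Hg : forall y, g y = Cmod2 (G y) * exp (al * ln (Cmod2 (y - c))) *
        exp (eps * Cmod2 (y - c))).
      { intros y; unfold g; rewrite exp_plus; ring. }
      assert (HX : forall y, 0 <= Cmod2 (G y) * exp (al * ln (Cmod2 (y - c)))).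
      { intros y; apply Rmult_le_pos; [apply Cmod2_pos|left; apply exp_pos]. }
      assert (HM : 0 <= M).
      { eapply Rle_trans; [apply (HX (c + RtoC r1)%C)|]. apply Hbd; left.
        replace (c + RtoC r1 - c)%C with (RtoC r1) by ring.
        rewrite Cmod_R, Rabs_pos_eq; lra. }
      assert (Hgm : g m <= M * exp (eps * (r3 * r3))).
      { assert (Hexp : exp (eps * Cmod2 (m - c)) <= exp (eps * (r3 * r3))).
        { assert (H := Hsq m Hm).
          assert (Hle : eps * Cmod2 (m - c) <= eps * (r3 * r3)) by nra.
          destruct Hle as [Hlt|Heq];
            [left; apply exp_increasing; assumption|rewrite Heq; lra]. }
        destruct (classic (Cmod (m - c) = r1 \/ Cmod (m - c) = r3)) as [Hb|Hb].
        - rewrite Hg. apply Rmult_le_compat;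
            [apply HX|left; apply exp_pos|apply Hbd; assumption|assumption].
        - destruct (classic (G m = RtoC 0)) as [H0|H0].
          + rewrite Hg, H0. unfold Cmod2 at 1. rewrite Cmod_0, !Rmult_0_l.
            apply Rmult_le_pos; [assumption|left; apply exp_pos].
          + exfalso.
            set (d := Rmin (Cmod (m - c) - r1) (r3 - Cmod (m - c))).
            apply (no_weighted_interior_max G m al eps c d).
            * apply HG, Hm.
            * assumption.
            * intros Hmc. apply (Hne m Hm). rewrite Hmc; ring.
            * assumption.
            * apply Rmin_pos; lra.
            * intros y Hy. apply Hmax.
              assert (H1 := Rlt_le_trans _ _ _ Hy (Rmin_l _ _)).
              assert (H2 := Rlt_le_trans _ _ _ Hy (Rmin_r _ _)).
              generalize (Cmod_triangle (y - m) (m - c))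
                (Cmod_triangle (m - y) (y - c)).
              rewrite (Cmod_sub_sym m y).
              replace (y - m + (m - c))%C with (y - c)%C by ring.
              replace (m - y + (y - c))%C with (m - c)%C by ring. lra. }
      apply Rle_trans with (g z);
        [|eapply Rle_trans; [apply Hmax, Hz|exact Hgm]].
      rewrite Hg.
      assert (1 <= exp (eps * Cmod2 (z - c))).
      { rewrite <- exp_0. assert (0 <= eps * Cmod2 (z - c))
          by (apply Rmult_le_pos; [lra|apply Cmod2_pos]).
        destruct H as [H|H]; [left; apply exp_increasing; assumption|
          rewrite <- H; lra]. }
      specialize (HX z). nra. }
  assert (HM : 0 <= M).
  { eapply Rle_trans; [|apply (Hbd (c + RtoC r1)%C)].
    - apply Rmult_le_pos; [apply Cmod2_pos|left; apply exp_pos].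
    - left. replace (c + RtoC r1 - c)%C with (RtoC r1) by ring.
      rewrite Cmod_R, Rabs_pos_eq; lra. }
  set (X := Cmod2 (G z) * exp (al * ln (Cmod2 (z - c)))) in *.
  apply Rnot_gt_le; intros Hgt.
  (* [eps r3^2 = ln (1 + t)], with [t] so small that [M (1 + t) < X] *)
  set (t := (X - M) / (2 * (M + 1))).
  assert (Ht : 0 < t) by (apply Rdiv_lt_0_compat; lra).
  assert (Hl : 0 < ln (1 + t)) by (rewrite <- ln_1; apply ln_increasing; lra).
  assert (Hr3 : 0 < r3 * r3) by nra.
  specialize (Heps (ln (1 + t) / (r3 * r3)) ltac:(apply Rdiv_lt_0_compat; lra)).
  replace (ln (1 + t) / (r3 * r3) * (r3 * r3)) with (ln (1 + t)) in Heps
    by (field; lra).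
  rewrite exp_ln in Heps by lra.
  assert (M * t <= (X - M) / 2); [|lra].
  replace ((X - M) / 2) with ((M + 1) * t) by (unfold t; field; lra). nra.
Qed.

(** The exponent [al] in [annulus_max] is chosen so that the two boundary
values of the bound on [|G| |z - c|^al] agree. *)
Lemma three_circles G c r1 r3 a U :
  0 < r1 -> r1 < r3 ->
  (forall z, r1 <= Cmod (z - c) <= r3 -> has_jet G z) ->
  (forall z, Cmod (z - c) = r1 -> Cmod (G z) <= exp (- a)) ->
  (forall z, Cmod (z - c) = r3 -> Cmod (G z) <= exp U) ->
  forall z, r1 <= Cmod (z - c) <= r3 ->
    Cmod (G z) <= exp (U - (a + U) * ln (r3 / Cmod (z - c)) / ln (r3 / r1)).
Proof.
  intros Hr1 Hr13 HG H1 H3 z Hz.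
  assert (Hl : ln (r3 / r1) = ln r3 - ln r1) by (apply ln_div; lra).
  assert (Hlz : ln (r3 / Cmod (z - c)) = ln r3 - ln (Cmod (z - c)))
    by (apply ln_div; lra).
  assert (Hlp : 0 < ln (r3 / r1)).
  { rewrite Hl. generalize (ln_increasing _ _ Hr1 Hr13); lra. }
  (* the exponent for which [e^-a r1^al = e^U r3^al] *)
  set (al := - ((a + U) / ln (r3 / r1))).
  set (m := exp (U + al * ln r3)).
  assert (Hw : forall y e, Cmod (y - c) <> 0 -> Cmod (G y) <= exp e ->
     Cmod2 (G y) * exp (al * ln (Cmod2 (y - c))) <=
     exp (e + al * ln (Cmod (y - c))) * exp (e + al * ln (Cmod (y - c)))).
  { intros y e Hy He. rewrite ln_Cmod2
      by (intros H0; apply Hy; rewrite H0, Cmod_0; reflexivity).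
    replace (exp (al * (2 * ln (Cmod (y - c))))) with
      (exp (al * ln (Cmod (y - c))) * exp (al * ln (Cmod (y - c))))
      by (rewrite <- exp_plus; f_equal; ring).
    rewrite exp_plus. unfold Cmod2.
    replace (Cmod (G y) * Cmod (G y) *
     (exp (al * ln (Cmod (y - c))) * exp (al * ln (Cmod (y - c))))) with
     ((Cmod (G y) * exp (al * ln (Cmod (y - c)))) *
      (Cmod (G y) * exp (al * ln (Cmod (y - c))))) by ring.
    assert (0 < exp (al * ln (Cmod (y - c)))) by apply exp_pos.
    assert (Hg := Cmod_ge_0 (G y)).
    apply Rmult_le_compat; nra. }
  assert (HX := annulus_max G c r1 r3 al (m * m) Hr1 (Rlt_le _ _ Hr13) HG).
  assert (Hb : forall y, Cmod (y - c) = r1 \/ Cmod (y - c) = r3 ->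
     Cmod2 (G y) * exp (al * ln (Cmod2 (y - c))) <= m * m).
  { intros y [Hy|Hy].
    - specialize (Hw y (- a) ltac:(lra) (H1 y Hy)). rewrite Hy in Hw.
      replace (- a + al * ln r1) with (U + al * ln r3) in Hw; [exact Hw|].
      unfold al; rewrite Hl in *; field; lra.
    - specialize (Hw y U ltac:(lra) (H3 y Hy)). rewrite Hy in Hw. exact Hw. }
  specialize (HX Hb z Hz).
  rewrite ln_Cmod2 in HX by (intros H0; rewrite H0, Cmod_0 in Hz; lra).
  replace (U - (a + U) * ln (r3 / Cmod (z - c)) / ln (r3 / r1)) with
    (U + al * ln r3 - al * ln (Cmod (z - c)))
    by (rewrite Hlz; unfold al; field; lra).
  set (e := exp (al * ln (Cmod (z - c)))).
  assert (He : 0 < e) by apply exp_pos.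
  replace (exp (al * (2 * ln (Cmod (z - c))))) with (e * e) in HX
    by (unfold e; rewrite <- exp_plus; f_equal; ring).
  unfold Rminus; rewrite exp_plus, exp_Ropp. fold m e.
  assert (Hm : 0 < m) by apply exp_pos.
  assert (Hge : Cmod (G z) * e <= m).
  { apply Rsqr_incr_0_var; [|lra]. unfold Rsqr.
    unfold Cmod2 in HX. lra. }
  replace (Cmod (G z)) with (Cmod (G z) * e * / e) by (field; lra).
  apply Rmult_le_compat_r; [left; apply Rinv_0_lt_compat|]; assumption.
Qed.

(** * Propagation of smallness *)

Lemma has_jet_minus_const G z k : has_jet G z -> has_jet (fun y => (G y - k)%C) z.
Proof.
  intros [a [b [c HJ]]]; exists (a - k)%C, b, c.
  intros eps He; destruct (HJ eps He) as [d [Hd K]]; exists d; split; [assumption|].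
  intros h Hh; specialize (K h Hh).
  replace (G (z + h) - k - (a - k + b * h + c * (h * h)))%C with
    (G (z + h) - (a + b * h + c * (h * h)))%C by ring. exact K.
Qed.

(** A Schwarz lemma with exponent 1/2.  The weight [|z - q| ^ (-1/2)] leaves
[|B z - B q| |z - q| ^ (-1/2)] tending to 0 at [q] by local Lipschitz
continuity alone, so only the outer circle counts.  The sharp exponent 1
would require control of the derivative at [q]. *)
Lemma holder_half B q r M :
  0 < r -> 0 < M ->
  (forall z, Cmod (z - q) <= r -> has_jet B z) ->
  (forall z, Cmod (z - q) <= r -> Cmod (B z) <= M) ->
  forall z, Cmod (z - q) <= r ->
    Cmod2 (B z - B q) <= 4 * (M * M) / r * Cmod (z - q).
Proof.
  intros Hr HM HJ HB z Hz.
  assert (Hq : Cmod (q - q) <= r).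
  { replace (q - q)%C with (RtoC 0) by ring. rewrite Cmod_0; lra. }
  destruct (Req_dec (Cmod (z - q)) 0) as [H0|H0].
  { assert (z = q) by (apply Cmod_eq_0 in H0;
      replace z with (z - q + q)%C by ring; rewrite H0; ring).
    subst z. rewrite H0. unfold Cmod2.
    replace (B q - B q)%C with (RtoC 0) by ring. rewrite Cmod_0; lra. }
  assert (Hzp : 0 < Cmod (z - q)) by (generalize (Cmod_ge_0 (z - q)); lra).
  set (X := 4 * (M * M) / r).
  assert (HX : 0 < X) by (apply Rdiv_lt_0_compat; nra).
  destruct (jet_lipschitz _ _ (HJ q Hq)) as [L [d [HL [Hd K]]]].
  set (e := Rmin (Rmin (d / 2) (Cmod (z - q))) (X / (L * L))).
  assert (He : 0 < e).
  { repeat apply Rmin_pos; try lra. apply Rdiv_lt_0_compat; nra. }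
  assert (He1 : e <= d / 2) by (eapply Rle_trans; [apply Rmin_l|apply Rmin_l]).
  assert (He2 : e <= Cmod (z - q))
    by (eapply Rle_trans; [apply Rmin_l|apply Rmin_r]).
  assert (He3 : e <= X / (L * L)) by apply Rmin_r.
  assert (Hw : forall y, 0 < Cmod (y - q) ->
    exp (- / 2 * ln (Cmod2 (y - q))) = / Cmod (y - q)).
  { intros y Hy. rewrite ln_Cmod2 by (apply Cmod_gt_0; assumption).
    replace (- / 2 * (2 * ln (Cmod (y - q)))) with (- ln (Cmod (y - q))) by field.
    rewrite exp_Ropp, exp_ln by assumption. reflexivity. }
  assert (HA := annulus_max (fun y => (B y - B q)%C) q e r (- / 2) X He ltac:(lra)).
  assert (Hz' : Cmod2 (B z - B q) * exp (- / 2 * ln (Cmod2 (z - q))) <= X).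
  { apply HA; [| |lra].
    - intros y Hy. apply has_jet_minus_const, HJ; lra.
    - intros y Hy. assert (Hyp : 0 < Cmod (y - q)) by (destruct Hy; lra).
      rewrite (Hw y Hyp). destruct Hy as [Hy|Hy]; rewrite Hy.
      + specialize (K y ltac:(lra)). rewrite Hy in K.
        assert (Cmod2 (B y - B q) <= (L * e) * (L * e)).
        { unfold Cmod2; apply Rmult_le_compat; try apply Cmod_ge_0; assumption. }
        apply Rle_trans with ((L * e) * (L * e) * / e).
        * apply Rmult_le_compat_r; [left; apply Rinv_0_lt_compat; lra|assumption].
        * replace (L * e * (L * e) * / e) with (L * L * e) by (field; lra).
          apply Rle_trans with (L * L * (X / (L * L)));
            [apply Rmult_le_compat_l; nra|right; field; nra].
      + unfold X, Rdiv. apply Rmult_le_compat_r;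
          [left; apply Rinv_0_lt_compat; lra|].
        assert (Cmod (B y - B q) <= 2 * M).
        { eapply Rle_trans; [apply Cmod_triangle|]. rewrite Cmod_opp.
          generalize (HB y ltac:(lra)) (HB q Hq); lra. }
        unfold Cmod2. generalize (Cmod_ge_0 (B y - B q)). nra. }
  rewrite (Hw z Hzp) in Hz'.
  replace (Cmod2 (B z - B q)) with
    (Cmod2 (B z - B q) * / Cmod (z - q) * Cmod (z - q)) by (field; lra).
  apply Rmult_le_compat_r; lra.
Qed.

(** Three circles with radii [r], [2 r], [4 r], where [2 r] is the geometric
mean of the other two. *)
Lemma small_disc_step G c r a U :
  0 < r -> 0 <= a + U ->
  (forall z, Cmod (z - c) <= 4 * r -> has_jet G z) ->
  (forall z, Cmod (z - c) <= 4 * r -> Cmod (G z) <= exp U) ->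
  (forall z, Cmod (z - c) <= r -> Cmod (G z) <= exp (- a)) ->
  forall z, Cmod (z - c) <= 2 * r -> Cmod (G z) <= exp (- ((a - U) / 2)).
Proof.
  intros Hr HaU HJ HU Ha z Hz.
  destruct (Rle_dec (Cmod (z - c)) r) as [H|H].
  { eapply Rle_trans; [apply Ha, H|]. apply exp_le; lra. }
  assert (H3 := three_circles G c r (4 * r) a U Hr ltac:(lra)).
  eapply Rle_trans; [apply H3; try (intros; apply HJ || apply HU || apply Ha; lra); lra|].
  apply exp_le.
  replace (4 * r / r) with (2 * 2) by (field; lra). rewrite ln_mult by lra.
  assert (Hl2 : 0 < ln 2) by (rewrite <- ln_1; apply ln_increasing; lra).
  assert (Hl : ln 2 <= ln (4 * r / Cmod (z - c))).
  { apply ln_le; [lra|]. apply Rmult_le_reg_r with (Cmod (z - c)); [lra|].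
    replace (4 * r / Cmod (z - c) * Cmod (z - c)) with (4 * r) by (field; lra). lra. }
  assert ((a + U) / 2 <= (a + U) * ln (4 * r / Cmod (z - c)) / (ln 2 + ln 2)).
  { replace ((a + U) / 2) with ((a + U) * ln 2 / (ln 2 + ln 2)) by (field; lra).
    unfold Rdiv; apply Rmult_le_compat_r; [left; apply Rinv_0_lt_compat; lra|].
    apply Rmult_le_compat_l; assumption. }
  lra.
Qed.

(** Each step sends the exponent [a] to [(a - U) / 2]; after [j] steps
[a / 2^j - U] is still a lower bound for it. *)
Lemma small_chain G (c : nat -> C) r a U N :
  0 < r -> 0 <= a -> 0 <= U ->
  (forall j, (j < N)%nat -> Cmod (c (S j) - c j) <= r) ->
  (forall j z, (j <= N)%nat -> Cmod (z - c j) <= 4 * r ->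
     has_jet G z /\ Cmod (G z) <= exp U) ->
  (forall z, Cmod (z - c O) <= r -> Cmod (G z) <= exp (- a)) ->
  forall z, Cmod (z - c N) <= r -> Cmod (G z) <= exp (- (a / 2 ^ N - U)).
Proof.
  intros Hr Ha HU Hc HG H0.
  assert (Hind : forall j, (j <= N)%nat -> forall z, Cmod (z - c j) <= r ->
     Cmod (G z) <= exp (- (a / 2 ^ j - U))).
  { induction j as [|j IH]; intros Hj z Hz.
    - eapply Rle_trans; [apply H0, Hz|]. apply exp_le. simpl; lra.
    - assert (Hp : 0 < 2 ^ j) by (apply pow_lt; lra).
      replace (a / 2 ^ S j - U) with (((a / 2 ^ j - U) - U) / 2)
        by (simpl; field; lra).
      apply small_disc_step with (c := c j) (r := r).
      + assumption.
      + replace (a / 2 ^ j - U + U) with (a / 2 ^ j) by ring.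
        apply Rmult_le_pos; [assumption|left; apply Rinv_0_lt_compat, Hp].
      + intros y Hy; apply (HG j y); [lia|assumption].
      + intros y Hy; apply (HG j y); [lia|assumption].
      + intros y Hy; apply IH; [lia|assumption].
      + generalize (Cmod_triangle (z - c (S j)) (c (S j) - c j)).
        replace (z - c (S j) + (c (S j) - c j))%C with (z - c j)%C by ring.
        specialize (Hc j ltac:(lia)). lra. }
  intros z Hz; apply Hind; [lia|exact Hz].
Qed.

(** The chain follows the arc from [p] to [z], cut into [N] equal pieces. *)
Lemma circle_chain p z s k N :
  0 < s -> Cmod p = s -> Cmod z = s -> PI <= k * INR N -> (0 < N)%nat ->
  exists c : nat -> C, c O = p /\ c N = z /\ (forall j, Cmod (c j) = s) /\
    forall j, Cmod (c (S j) - c j) <= k * s.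
Proof.
  intros Hs Hp Hz Hk HN.
  assert (Hp0 : p <> RtoC 0) by (apply Cmod_gt_0; lra).
  assert (HN' : 0 < INR N) by (apply lt_0_INR; assumption).
  destruct (cis_surj (z / p)) as [t [Ht Hzt]].
  { rewrite Cmod_div by assumption. rewrite Hp, Hz; field; lra. }
  exists (fun j => (p * cis (t * INR j / INR N))%C); repeat split.
  - replace (t * INR 0 / INR N) with 0 by (simpl; field; lra).
    unfold cis; rewrite cos_0, sin_0. change (p * RtoC 1 = p)%C. ring.
  - replace (t * INR N / INR N) with t by (field; lra).
    rewrite <- Hzt. field; assumption.
  - intros j. rewrite Cmod_mult, Cmod_cis, Hp; ring.
  - intros j. rewrite S_INR.
    replace (t * (INR j + 1) / INR N) with (t / INR N + t * INR j / INR N)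
      by (field; lra).
    rewrite cis_plus. set (e := cis (t * INR j / INR N)).
    replace (p * (cis (t / INR N) * e) - p * e)%C with
      (p * e * (cis (t / INR N) - 1))%C by ring.
    rewrite !Cmod_mult, Hp. unfold e at 1. rewrite Cmod_cis.
    assert (H := Cmod_cis_minus_1 (t / INR N)).
    unfold Rdiv in H at 2. rewrite Rabs_mult in H.
    rewrite (Rabs_pos_eq (/ INR N)) in H
      by (left; apply Rinv_0_lt_compat; assumption).
    assert (Rabs t * / INR N <= k).
    { apply Rmult_le_reg_r with (INR N); [assumption|].
      replace (Rabs t * / INR N * INR N) with (Rabs t) by (field; lra). lra. }
    rewrite Rmult_1_r, Rmult_comm. apply Rmult_le_compat_r; lra.
Qed.

(** If [G] were smaller than this on the disc around [p], the chain of discs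
would make it small on the whole circle [|z| = s], and Hadamard's theorem on
[s <= |z| <= r0] would make [|G z1|] smaller than it is.  The number of discs
depends on [k] only; the factor [ln (/ s)] is the price of the three circles
step, because [z1] and [r0] stay fixed while [s] tends to 0. *)
Lemma lower_bound_in_disc G rho r0 z1 k :
  r0 < rho -> r0 <= 1 -> 0 < Cmod z1 < r0 -> G z1 <> RtoC 0 -> 0 < k <= / 8 ->
  (forall z, 0 < Cmod z < rho -> has_jet G z) ->
  exists A, 0 < A /\ forall s p U,
    0 < s -> s < Cmod z1 -> s <= r0 / 2 -> Cmod p = s -> 1 <= U ->
    (forall z, s / 2 <= Cmod z <= r0 -> Cmod (G z) <= exp U) ->
    exists q, Cmod (q - p) <= k * s /\ exp (- (A * U * ln (/ s))) < Cmod (G q).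
Proof.
  intros Hrho Hr01 Hz1 HG1 Hk HJ.
  assert (HPI := PI_RGT_0).
  destruct (archimed_cor1 (k / PI)) as [N [HN HN0]].
  { apply Rdiv_lt_0_compat; lra. }
  assert (HNp : 0 < INR N) by (apply lt_0_INR; assumption).
  assert (HkN : PI <= k * INR N).
  { apply Rmult_lt_compat_r with (r := PI * INR N) in HN; [|nra].
    replace (/ INR N * (PI * INR N)) with PI in HN by (field; lra).
    replace (k / PI * (PI * INR N)) with (k * INR N) in HN by (field; lra). lra. }
  assert (HG1' : 0 < Cmod (G z1)) by (apply Cmod_gt_0; assumption).
  set (V := Rabs (ln (Cmod (G z1)))).
  assert (HV : 0 <= V) by apply Rabs_pos.
  set (L1 := ln (r0 / Cmod z1)).
  assert (HL1 : 0 < L1) by (apply ln_lt_pos; lra).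
  assert (H2N : 0 < 2 ^ N) by (apply pow_lt; lra).
  exists (2 ^ N * (2 + V) / L1); split; [apply Rdiv_lt_0_compat; nra|].
  intros s p U Hs Hsz Hs0 Hp HU HGU.
  apply NNPP; intros Hno.
  set (a := 2 ^ N * (2 + V) / L1 * U * ln (/ s)) in *.
  assert (Hls : 0 < ln (/ s)).
  { rewrite <- ln_1. apply ln_increasing; [lra|]. rewrite <- Rinv_1.
    apply Rinv_lt_contravar; lra. }
  assert (Ha : 0 < a).
  { unfold a. repeat apply Rmult_lt_0_compat; try lra.
    apply Rinv_0_lt_compat; lra. }
  assert (Hsmall : forall z, Cmod (z - p) <= k * s -> Cmod (G z) <= exp (- a)).
  { intros z Hz. apply Rnot_lt_le; intros Hlt. apply Hno; exists z; tauto. }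
  assert (Hcirc : forall z, Cmod (z - 0) = s ->
    Cmod (G z) <= exp (- (a / 2 ^ N - U))).
  { intros z Hz. replace (z - 0)%C with z in Hz by ring.
    destruct (circle_chain p z s k N Hs Hp Hz HkN HN0) as [c [H0 [H1 [H2 H3]]]].
    apply small_chain with (c := c) (r := k * s).
    - nra.
    - lra.
    - lra.
    - intros j _; apply H3.
    - intros j y _ Hy.
      assert (Hy' : Rabs (Cmod y - s) <= s / 2).
      { rewrite <- (H2 j). apply Rabs_le.
        generalize (Cmod_triangle_rev y (c j)) (Cmod_triangle_rev (c j) y).
        rewrite (Cmod_sub_sym (c j) y). rewrite (H2 j). intros.
        assert (4 * (k * s) <= s / 2) by nra. lra. }
      apply Rabs_le_between in Hy'.
      split; [apply HJ; lra|apply HGU; lra].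
    - rewrite H0; exact Hsmall.
    - rewrite H1. replace (z - z)%C with (RtoC 0) by ring. rewrite Cmod_0; nra. }
  assert (Hz10 : Cmod (z1 - 0) = Cmod z1) by (f_equal; ring).
  assert (H3 := three_circles G 0 s r0 (a / 2 ^ N - U) U Hs ltac:(lra)).
  specialize (H3 ltac:(intros y; replace (y - 0)%C with y by ring;
     intros; apply HJ; lra) Hcirc).
  specialize (H3 ltac:(intros y; replace (y - 0)%C with y by ring;
     intros; apply HGU; lra) z1 ltac:(rewrite Hz10; lra)).
  rewrite Hz10 in H3. fold L1 in H3.
  assert (Hls0 : 0 < ln (r0 / s)) by (apply ln_lt_pos; lra).
  assert (Hlle : ln (r0 / s) <= ln (/ s)).
  { apply ln_le; [apply Rdiv_lt_0_compat; lra|]. unfold Rdiv.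
    assert (0 < / s) by (apply Rinv_0_lt_compat; lra). nra. }
  assert (Hkey : (2 + V) * U <= (a / 2 ^ N - U + U) * L1 / ln (r0 / s)).
  { replace ((a / 2 ^ N - U + U) * L1 / ln (r0 / s)) with
      ((2 + V) * U * (ln (/ s) / ln (r0 / s))) by (unfold a; field; lra).
    assert (1 <= ln (/ s) / ln (r0 / s)).
    { apply Rmult_le_reg_r with (ln (r0 / s)); [assumption|].
      replace (ln (/ s) / ln (r0 / s) * ln (r0 / s)) with (ln (/ s))
        by (field; lra). lra. }
    assert (0 < (2 + V) * U) by nra. nra. }
  apply ln_le in H3; [|assumption]. rewrite ln_exp in H3.
  assert (- V <= ln (Cmod (G z1))).
  { unfold V. generalize (Rabs_maj2 (ln (Cmod (G z1)))); lra. }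
  nra.
Qed.

(** The identity theorem in the form needed here: a function vanishing on a
whole circle is, by three circles with an arbitrarily small inner bound, zero
outside that circle. *)
Lemma nonzero_on_circle G rho z0 s :
  (forall z, 0 < Cmod z < rho -> has_jet G z) ->
  0 < Cmod z0 < rho -> G z0 <> RtoC 0 -> 0 < s < Cmod z0 ->
  exists z, Cmod z = s /\ G z <> RtoC 0.
Proof.
  intros HJ Hz0 HG0 Hs. apply NNPP; intros Hno.
  assert (E0 : forall z, Cmod (z - 0) = Cmod z) by (intros; f_equal; ring).
  set (r3 := (Cmod z0 + rho) / 2).
  destruct (bounded_on_circle G r3) as [M [HM HGM]].
  { intros z Hz. apply has_jet_continuous_Cmod2, HJ. unfold r3 in Hz; lra. }
  assert (HG0' : 0 < Cmod (G z0)) by (apply Cmod_gt_0; assumption).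
  set (l := ln (r3 / Cmod z0) / ln (r3 / s)).
  assert (Hl : 0 < l).
  { apply Rdiv_lt_0_compat; apply ln_lt_pos; unfold r3; lra. }
  set (a := (ln M - ln (Cmod (G z0)) + 1) / l - ln M).
  assert (H3 := three_circles G 0 s r3 a (ln M) ltac:(lra) ltac:(unfold r3; lra)).
  specialize (H3 ltac:(intros y; rewrite E0; intros; apply HJ; unfold r3 in *; lra)).
  assert (Hin : forall z, Cmod (z - 0) = s -> Cmod (G z) <= exp (- a)).
  { intros z Hz. rewrite E0 in Hz. destruct (classic (G z = RtoC 0)) as [H|H].
    - rewrite H, Cmod_0. left; apply exp_pos.
    - exfalso; apply Hno; exists z; tauto. }
  specialize (H3 Hin).
  specialize (H3 ltac:(intros y; rewrite E0, exp_ln by assumption; apply HGM) z0).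
  rewrite E0 in H3. specialize (H3 ltac:(unfold r3; lra)).
  apply ln_le in H3; [|assumption]. rewrite ln_exp in H3.
  replace ((a + ln M) * ln (r3 / Cmod z0) / ln (r3 / s)) with
    (ln M - ln (Cmod (G z0)) + 1) in H3; [lra|].
  unfold a.
  replace ((ln M - ln (Cmod (G z0)) + 1) / l - ln M + ln M) with
    ((ln M - ln (Cmod (G z0)) + 1) / l) by ring.
  assert (0 < ln (r3 / s)) by (apply ln_lt_pos; unfold r3; lra).
  assert (0 < ln (r3 / Cmod z0)) by (apply ln_lt_pos; unfold r3; lra).
  unfold l; field; lra.
Qed.

(** Three circles around [q] with radii [d], [|q1 - q|], [r].  The loss is only
the factor [ln (r / d)], so [d] may be exponentially small. *)
Lemma lower_bound_in_smaller_disc G q q1 r d U V :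
  0 < d -> d <= r / 2 -> 0 <= U -> 0 <= V ->
  (forall z, Cmod (z - q) <= r -> has_jet G z) ->
  (forall z, Cmod (z - q) <= r -> Cmod (G z) <= exp U) ->
  Cmod (q1 - q) <= r / 2 -> exp (- V) < Cmod (G q1) ->
  exists q2, Cmod (q2 - q) <= d /\
    exp (- ((U + V) * ln (r / d) / ln 2)) < Cmod (G q2).
Proof.
  intros Hd Hdr HU HV HJ HGU Hq1 HG1. apply NNPP; intros Hno.
  set (a := (U + V) * ln (r / d) / ln 2) in *.
  assert (Hl2 : 0 < ln 2) by (rewrite <- ln_1; apply ln_increasing; lra).
  assert (Hlr : forall t, 0 < t -> t <= r / 2 -> ln 2 <= ln (r / t)).
  { intros t Ht Htr. apply ln_le; [lra|].
    apply Rmult_le_reg_r with t; [assumption|].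
    replace (r / t * t) with r by (field; lra). lra. }
  assert (Hld := Hlr d Hd Hdr).
  assert (Ha : U + V <= a).
  { unfold a. replace (U + V) with ((U + V) * ln 2 / ln 2) at 1 by (field; lra).
    unfold Rdiv; apply Rmult_le_compat_r; [left; apply Rinv_0_lt_compat; lra|].
    apply Rmult_le_compat_l; lra. }
  assert (Hsmall : forall z, Cmod (z - q) <= d -> Cmod (G z) <= exp (- a)).
  { intros z Hz; apply Rnot_lt_le; intros Hlt; apply Hno; exists z; tauto. }
  assert (Hle : Cmod (G q1) <= exp (- V)); [|lra].
  destruct (Rle_dec (Cmod (q1 - q)) d) as [H|H].
  { eapply Rle_trans; [apply Hsmall, H|]. apply exp_le; lra. }
  assert (H3 := three_circles G q d r a U Hd ltac:(lra)).
  eapply Rle_trans;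
    [apply H3; try (intros; apply HJ || apply HGU || apply Hsmall; lra); lra|].
  apply exp_le.
  assert (Hlq := Hlr (Cmod (q1 - q)) ltac:(lra) Hq1).
  assert (U + V <= (a + U) * ln (r / Cmod (q1 - q)) / ln (r / d)); [|lra].
  replace (U + V) with (a * ln 2 / ln (r / d)) by (unfold a; field; lra).
  unfold Rdiv; apply Rmult_le_compat_r; [left; apply Rinv_0_lt_compat; lra|].
  apply Rmult_le_compat; lra.
Qed.

(** * Logarithmic derivatives at a maximum point *)

(** [K] is at least twice the oscillation [U + V] of [ln |f|], which forces the
maximum of [|f|^2 (d^2 - |z - q|^2)^K] to a point where
[d^2 - |z - q|^2 >= d^2 / 4]; there the derivatives of the logarithm of the
weight are at most [K / d] and [K / d^2], up to constants, and those of
[ln |f|^2] are their opposites to first order and are dominated by them to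
second order. *)
Lemma log_derivative_bound f q q2 d U V (K : nat) :
  0 < d -> (1 <= K)%nat -> 2 * (U + V) <= INR K ->
  (forall z, Cmod (z - q) <= d -> has_jet f z) ->
  (forall z, Cmod (z - q) <= d -> Cmod (f z) <= exp U) ->
  Cmod (q2 - q) <= d / 2 -> exp (- V) < Cmod (f q2) ->
  exists z, Cmod (z - q) <= d /\ f z <> RtoC 0 /\
    forall a b c, jet f z a b c ->
      Cmod (b / a) <= 4 * INR K / d /\
      Cmod (c / a) <= 36 * (INR K * INR K) / (d * d).
Proof.
  intros Hd HK HKUV HJ HfU Hq2 Hf2.
  assert (HK1 : 1 <= INR K) by (apply (le_INR 1); assumption).
  set (w := fun y => d * d + -1 * Cmod2 (y - q)).
  set (g := fun y => Cmod2 (f y) * w y ^ K).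
  assert (Hw0 : forall y, Cmod (y - q) <= d -> 0 <= w y).
  { intros y Hy. unfold w, Cmod2. generalize (Cmod_ge_0 (y - q)); nra. }
  assert (Hwc : forall y, continuous_C w y).
  { intros y. apply continuous_C_plus; [apply continuous_C_const|].
    apply continuous_C_mult; [apply continuous_C_const|].
    apply continuous_C_Cmod2_translate. }
  destruct (attains_max (fun y => 0 <= Cmod (y - q) <= d) (d + Cmod q) g)
    as [z [Hz Hmax]].
  - intros y Hy. generalize (Cmod_triangle (y - q) q).
    replace (y - q + q)%C with y by ring. lra.
  - apply closed_annulus.
  - intros y Hy e He.
    assert (Hcont : continuous_C g y).
    { apply continuous_C_mult; [apply has_jet_continuous_Cmod2, HJ, Hy|].
      apply (continuous_C_comp w (fun x => x ^ K)); [apply Hwc|].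
      apply derivable_continuous_pt, derivable_pt_pow. }
    destruct (continuous_C_elim _ _ Hcont e He) as [dd [Hdd K1]].
    exists dd; split; [assumption|]; intros y' _ Hy'.
    specialize (K1 y' Hy'); apply Rabs_lt_between in K1; lra.
  - exists q. replace (q - q)%C with (RtoC 0) by ring. rewrite Cmod_0; lra.
  - destruct Hz as [_ Hz].
    assert (He1 : / 3 <= exp (-1)).
    { change (-1) with (- (1)); rewrite exp_Ropp. apply Rinv_le_contravar; [apply exp_pos|apply exp_le_3]. }
    assert (Hg2 : exp (- V) * exp (- V) * (3 / 4 * (d * d)) ^ K <= g z).
    { eapply Rle_trans; [|apply (Hmax q2); generalize (Cmod_ge_0 (q2 - q)); lra].
      unfold g. apply Rmult_le_compat.
      - generalize (exp_pos (- V)); nra.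
      - apply pow_le; nra.
      - unfold Cmod2. generalize (exp_pos (- V)); intros; nra.
      - apply pow_incr; split; [nra|]. unfold w, Cmod2.
        generalize (Cmod_ge_0 (q2 - q)); nra. }
    assert (HgU : g z <= exp U * exp U * w z ^ K).
    { unfold g. apply Rmult_le_compat_r; [apply pow_le, Hw0, Hz|].
      unfold Cmod2. specialize (HfU z Hz). generalize (Cmod_ge_0 (f z)); nra. }
    assert (Hpow : (exp (-1) * (3 / 4 * (d * d))) ^ K <= w z ^ K).
    { rewrite Rpow_mult_distr.
      assert (E : exp (-1) ^ K = exp (- INR K)).
      { clear. induction K as [|K IH]; [simpl; rewrite Ropp_0, exp_0; reflexivity|].
        rewrite S_INR. simpl pow. rewrite IH, <- exp_plus. f_equal; ring. }
      rewrite E.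
      assert (HeK : exp (- INR K) <= exp (- V) * exp (- V) * (exp (- U) * exp (- U))).
      { rewrite <- !exp_plus. apply exp_le; lra. }
      assert (HUU : exp U * exp (- U) = 1).
      { rewrite <- exp_plus, Rplus_opp_r; apply exp_0. }
      assert (Hp34 : 0 <= (3 / 4 * (d * d)) ^ K) by (apply pow_le; nra).
      apply Rle_trans with
        (exp (- U) * exp (- U) * (exp (- V) * exp (- V) * (3 / 4 * (d * d)) ^ K)).
      - replace (exp (- U) * exp (- U) * (exp (- V) * exp (- V) * (3 / 4 * (d * d)) ^ K))
         with (exp (- V) * exp (- V) * (exp (- U) * exp (- U)) * (3 / 4 * (d * d)) ^ K)
         by ring.
        apply Rmult_le_compat_r; assumption.
      - apply Rle_trans with (exp (- U) * exp (- U) * (exp U * exp U * w z ^ K)).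
        + apply Rmult_le_compat_l; [generalize (exp_pos (- U)); nra|lra].
        + right. replace (exp (- U) * exp (- U) * (exp U * exp U * w z ^ K)) with
            ((exp U * exp (- U)) * (exp U * exp (- U)) * w z ^ K) by ring.
          rewrite HUU; ring. }
    (* [3 exp (-1) / 4 >= 1 / 4]: below that level the weight alone would bring
       [g z] under its value at [q2] *)
    assert (Hwz : d * d / 4 <= w z).
    { apply Rnot_lt_le; intros Hlt.
      assert (w z ^ K < (exp (-1) * (3 / 4 * (d * d))) ^ K); [|lra].
      destruct K as [|K']; [lia|]. apply Rlt_le_trans with ((d * d / 4) ^ S K').
      - assert (Hmono : forall n x y, 0 <= x -> x < y -> x ^ S n < y ^ S n).
        { intros n x y Hx Hxy; induction n as [|n IH]; [simpl; lra|].
          change (x * x ^ S n < y * y ^ S n).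
          assert (0 <= x ^ S n) by (apply pow_le; assumption). nra. }
        apply Hmono; [apply Hw0, Hz|assumption].
      - apply pow_incr; split; nra. }
    assert (Hgz : 0 < g z).
    { eapply Rlt_le_trans; [|exact Hg2]. repeat apply Rmult_lt_0_compat;
        try apply exp_pos. apply pow_lt; nra. }
    assert (Hfz : f z <> RtoC 0).
    { intros H0. unfold g in Hgz. rewrite H0 in Hgz. unfold Cmod2 in Hgz.
      rewrite Cmod_0 in Hgz. lra. }
    exists z; split; [assumption|split; [assumption|]].
    intros a b c Hj.
    assert (Ea := jet_value _ _ _ _ _ Hj).
    assert (Hwp : 0 < w z) by nra.
    set (y := (z - q)%C) in *.
    assert (J1 := real_jet_ln_Cmod2 _ _ _ _ _ Hj ltac:(rewrite <- Ea; exact Hfz)).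
    assert (J2 := real_jet_ln w z _ _ _ (real_jet_Cmod2_center (d * d) (-1) q z) Hwp).
    assert (J := real_jet_plus _ _ _ _ _ _ _ _ _ J1
      (real_jet_scal (INR K) _ _ _ _ _ J2)).
    apply real_jet_max in J.
    2:{ destruct (continuous_C_elim _ _ (Hwc z) _ Hwp) as [d1 [Hd1 K1]].
        assert (HG2 := Cmod2_gt_0 _ Hfz).
        destruct (continuous_C_elim _ _ (has_jet_continuous_Cmod2 _ _
          (HJ z Hz)) _ HG2) as [d2 [Hd2 K2]].
        exists (Rmin d1 d2); split; [apply Rmin_pos; assumption|].
        intros h Hh.
        assert (Eh : (z + h - z)%C = h) by ring.
        assert (Hh1 : Cmod (z + h - z) < d1)
          by (rewrite Eh; eapply Rlt_le_trans; [exact Hh|apply Rmin_l]).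
        assert (Hh2 : Cmod (z + h - z) < d2)
          by (rewrite Eh; eapply Rlt_le_trans; [exact Hh|apply Rmin_r]).
        specialize (K1 _ Hh1). specialize (K2 _ Hh2).
        apply Rabs_lt_between in K1. apply Rabs_lt_between in K2.
        set (v := (z + h)%C) in *.
        assert (Hvin : 0 <= Cmod (v - q) <= d).
        { split; [apply Cmod_ge_0|]. assert (Hwv : 0 < w v) by lra.
          unfold w, Cmod2 in Hwv. generalize (Cmod_ge_0 (v - q)); nra. }
        specialize (Hmax v Hvin). unfold g in Hmax.
        apply ln_le in Hmax;
          [|apply Rmult_lt_0_compat; [lra|apply pow_lt; lra]].
        rewrite !ln_mult, !ln_pow in Hmax by (try apply pow_lt; lra). lra. }
    fold y in J. destruct J as [J1' J2'].
    set (D := w z) in *. set (k := INR K) in *.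
    set (P := (RtoC (2 * -1) * Cconj y)%C) in *.
    assert (HP : Cmod P = 2 * Cmod y).
    { unfold P. rewrite Cmod_mult, Cmod_conj, Cmod_R, Rabs_left1; lra. }
    assert (Hy0 := Cmod_ge_0 y).
    assert (HiD : / D <= 4 / (d * d)).
    { replace (4 / (d * d)) with (/ (d * d / 4)) by (field; lra).
      apply Rinv_le_contravar; nra. }
    assert (HiD0 : 0 < / D) by (apply Rinv_0_lt_compat; assumption).
    assert (Hyd : Cmod y * / D <= 4 / d).
    { replace (4 / d) with (d * (4 / (d * d))) by (field; lra).
      apply Rmult_le_compat; lra. }
    assert (Hyd2 : Cmod y * / D * (Cmod y * / D) <= 16 / (d * d)).
    { replace (16 / (d * d)) with (4 / d * (4 / d)) by (field; lra).
      assert (0 <= Cmod y * / D) by nra. apply Rmult_le_compat; lra. }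
    set (u := (b / a)%C) in *. set (v := (c / a)%C) in *.
    assert (Eu : u = (- (RtoC (/ 2) * (RtoC k * (RtoC (/ D) * P))))%C).
    { replace u with (RtoC (/ 2) * (RtoC 2 * u + RtoC k * (RtoC (/ D) * P)) -
        RtoC (/ 2) * (RtoC k * (RtoC (/ D) * P)))%C.
      - rewrite J1'. ring.
      - replace (RtoC (/ 2)) with (/ RtoC 2)%C by (rewrite RtoC_inv; [reflexivity|lra]).
        field. }
    assert (Hu : Cmod u <= 4 * k / d).
    { rewrite Eu, Cmod_opp, !Cmod_mult, !Cmod_R, HP.
      rewrite !Rabs_pos_eq by lra.
      replace (/ 2 * (k * (/ D * (2 * Cmod y)))) with (k * (Cmod y * / D))
        by (field; lra).
      replace (4 * k / d) with (k * (4 / d)) by (field; lra).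
      apply Rmult_le_compat_l; lra. }
    split; [exact Hu|].
    set (Q := (RtoC k * (RtoC (/ D) * RtoC 0 + RtoC (- / (4 * (D * D))) * (P * P)))%C) in *.
    assert (HQ : Cmod Q <= 16 * k / (d * d)).
    { unfold Q. rewrite Cmult_0_r, Cplus_0_l, !Cmod_mult, HP, !Cmod_R.
      rewrite (Rabs_pos_eq k) by lra.
      rewrite Rabs_Ropp, Rabs_pos_eq
        by (left; apply Rinv_0_lt_compat; nra).
      replace (k * (/ (4 * (D * D)) * (2 * Cmod y * (2 * Cmod y)))) with
        (k * (Cmod y * / D * (Cmod y * / D))) by (field; lra).
      replace (16 * k / (d * d)) with (k * (16 / (d * d))) by (field; lra).
      apply Rmult_le_compat_l; lra. }
    assert (HS : -2 * (0 + k * (-1 / D - Cmod P * Cmod P / (4 * (D * D)))) <=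
      40 * k / (d * d)).
    { rewrite HP. replace (-2 * (0 + k * (-1 / D - 2 * Cmod y * (2 * Cmod y) / (4 * (D * D)))))
        with (2 * k * (/ D + Cmod y * / D * (Cmod y * / D))) by (field; lra).
      replace (40 * k / (d * d)) with (2 * k * (4 / (d * d) + 16 / (d * d)))
        by (field; lra).
      apply Rmult_le_compat_l; lra. }
    assert (Ev : (RtoC 2 * v)%C = ((RtoC 2 * v - u * u + Q) + (u * u - Q))%C) by ring.
    assert (Hv : 2 * Cmod v <= 40 * k / (d * d) + 16 * (k * k) / (d * d) + 16 * k / (d * d)).
    { replace (2 * Cmod v) with (Cmod (RtoC 2 * v))
        by (rewrite Cmod_mult, Cmod_R, Rabs_pos_eq; lra).
      rewrite Ev. eapply Rle_trans; [apply Cmod_triangle|].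
      assert (T := Cmod_triangle (u * u) (- Q)). rewrite Cmod_opp, Cmod_mult in T.
      assert (Cmod u * Cmod u <= 16 * (k * k) / (d * d)).
      { replace (16 * (k * k) / (d * d)) with (4 * k / d * (4 * k / d)) by (field; lra).
        generalize (Cmod_ge_0 u); intros; apply Rmult_le_compat; lra. }
      change (u * u - Q)%C with (u * u + - Q)%C. lra. }
    assert (Hkk : k / (d * d) <= k * k / (d * d)).
    { unfold Rdiv; apply Rmult_le_compat_r;
        [left; apply Rinv_0_lt_compat; nra|nra]. }
    replace (36 * (k * k) / (d * d)) with (36 * (k * k / (d * d))) by (field; lra).
    replace (40 * k / (d * d) + 16 * (k * k) / (d * d) + 16 * k / (d * d)) with
      (56 * (k / (d * d)) + 16 * (k * k / (d * d))) in Hv by (field; lra).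
    lra.
Qed.

(** * Jets of power series and of solutions *)

Lemma pow_n_Cpow (x : C) k : @pow_n C_AbsRing x k = (x ^ k)%C.
Proof. induction k as [|k IH]; [reflexivity|]. simpl; rewrite IH; reflexivity. Qed.

(** The terms of a power series are bounded at half its radius, so the tail
beyond the quadratic term is [O(|h|^3)] by comparison with a geometric
series. *)
Lemma analytic_has_jet f z : analytic_at f z -> has_jet f z.
Proof.
  intros [a [rho [Hrho Hf]]].
  exists (a 0%nat), (a 1%nat), (a 2%nat).
  set (u := fun (h : C) k => (h ^ k * a k)%C).
  set (S := fun h n => @sum_n C_AbelianMonoid (u h) n).
  assert (HS : forall h, Cmod h < rho -> forall eps : posreal,
    eventually (fun n => Cmod (S h n - f (z + h)%C) < eps)).
  { intros h Hh eps. specialize (Hf (z + h)%C).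
    replace (z + h - z)%C with h in Hf by ring. specialize (Hf Hh).
    unfold is_pseries, is_series in Hf.
    apply filterlim_locally_ball_norm with (eps := eps) in Hf.
    destruct Hf as [N HN]; exists N; intros n Hn. specialize (HN n Hn).
    assert (E : S h n = @sum_n C_AbelianMonoid
      (fun k => @scal C_AbsRing C_NormedModule (@pow_n C_AbsRing h k) (a k)) n).
    { apply sum_n_ext; intros k; unfold u; rewrite <- (pow_n_Cpow h k); reflexivity. }
    rewrite E; exact HN. }
  set (r := rho / 2).
  assert (HM : exists M, 0 < M /\ forall k, r ^ k * Cmod (a k) <= M).
  { destruct (@filterlim_bounded C_AbsRing C_NormedModule (S (RtoC r))) as [M HM].
    { exists (f (z + RtoC r)%C). apply filterlim_locally_ball_norm.
      intros eps. apply HS. rewrite Cmod_R, Rabs_pos_eq; unfold r; lra. }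
    assert (HM0 : forall n, Cmod (S (RtoC r) n) <= M) by exact HM.
    exists (2 * M + 1); split.
    { generalize (HM0 0%nat) (Cmod_ge_0 (S (RtoC r) 0%nat)); lra. }
    intros k.
    assert (E : Cmod (u (RtoC r) k) = r ^ k * Cmod (a k)).
    { unfold u. rewrite Cmod_mult, Cmod_pow, Cmod_R, Rabs_pos_eq; unfold r; lra. }
    rewrite <- E. destruct k as [|k].
    - replace (u (RtoC r) 0%nat) with (S (RtoC r) 0%nat)
        by (unfold S; rewrite sum_O; reflexivity).
      generalize (HM0 0%nat) (Cmod_ge_0 (S (RtoC r) 0%nat)); lra.
    - replace (u (RtoC r) (Datatypes.S k)) with
        (S (RtoC r) (Datatypes.S k) - S (RtoC r) k)%C.
      + eapply Rle_trans; [apply Cmod_triangle|]. rewrite Cmod_opp.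
        generalize (HM0 (Datatypes.S k)) (HM0 k); lra.
      + unfold S; rewrite sum_Sn. change plus with Cplus. ring. }
  destruct HM as [M [HM0 HM]].
  assert (Hr : 0 < r) by (unfold r; lra).
  assert (Hpart : forall h n, Cmod h <= r / 2 ->
    Cmod (S h (n + 2)%nat - (a 0%nat + a 1%nat * h + a 2%nat * (h * h)))
    <= M * (Cmod h / r) ^ 3 * (2 - 2 * (/ 2) ^ n)).
  { intros h n Hh. induction n as [|n IH].
    - replace (S h (0 + 2)%nat) with (a 0%nat + a 1%nat * h + a 2%nat * (h * h))%C.
      + replace (a 0%nat + a 1%nat * h + a 2%nat * (h * h) -
          (a 0%nat + a 1%nat * h + a 2%nat * (h * h)))%C with (RtoC 0) by ring.
        rewrite Cmod_0. simpl; lra.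
      + unfold S; simpl Init.Nat.add. rewrite !sum_Sn, sum_O.
        unfold u; change plus with Cplus; simpl Cpow. ring.
    - replace (Datatypes.S n + 2)%nat with (Datatypes.S (n + 2)) by lia.
      replace (S h (Datatypes.S (n + 2))) with (S h (n + 2)%nat + u h (n + 3)%nat)%C.
      2:{ unfold S; rewrite sum_Sn. change plus with Cplus.
          replace (Datatypes.S (n + 2)) with (n + 3)%nat by lia. reflexivity. }
      set (P := (a 0%nat + a 1%nat * h + a 2%nat * (h * h))%C) in *.
      replace (S h (n + 2)%nat + u h (n + 3)%nat - P)%C with
        ((S h (n + 2)%nat - P) + u h (n + 3)%nat)%C by ring.
      eapply Rle_trans; [apply Cmod_triangle|].
      assert (Hx := Cmod_ge_0 h).
      assert (Hu : Cmod (u h (n + 3)%nat) <= M * (Cmod h / r) ^ 3 * (/ 2) ^ n).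
      { unfold u. rewrite Cmod_mult, Cmod_pow.
        replace (Cmod h ^ (n + 3)) with ((Cmod h / r) ^ (n + 3) * r ^ (n + 3))
          by (rewrite <- Rpow_mult_distr; f_equal; field; lra).
        rewrite Rmult_assoc.
        assert (Ht : 0 <= Cmod h / r <= / 2).
        { split; [apply Rmult_le_pos; [assumption|
            left; apply Rinv_0_lt_compat; lra]|].
          apply Rmult_le_reg_r with r; [assumption|].
          replace (Cmod h / r * r) with (Cmod h) by (field; lra). lra. }
        set (t := Cmod h / r) in *.
        apply Rle_trans with (t ^ (n + 3) * M).
        - apply Rmult_le_compat_l; [apply pow_le; lra|apply HM].
        - rewrite pow_add.
          assert (t ^ n <= (/ 2) ^ n) by (apply pow_incr; lra).
          assert (0 <= t ^ 3 * M)
            by (apply Rmult_le_pos; [apply pow_le|]; lra). nra. }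
      simpl pow at 2. simpl pow in Hu at 2. lra. }
  assert (Hlim : forall h, Cmod h <= r / 2 ->
    Cmod (f (z + h) - (a 0%nat + a 1%nat * h + a 2%nat * (h * h)))%C
    <= 2 * M * (Cmod h / r) ^ 3).
  { intros h Hh. apply le_epsilon. 
    intros eps He.
    destruct (HS h ltac:(unfold r in *; lra) (mkposreal eps He)) as [N HN].
    specialize (HN (N + 2)%nat ltac:(lia)). specialize (Hpart h N Hh).
    set (P := (a 0%nat + a 1%nat * h + a 2%nat * (h * h))%C) in *.
    simpl in HN. rewrite Cmod_sub_sym in HN.
    replace (f (z + h) - P)%C with
      ((f (z + h) - S h (N + 2)%nat) + (S h (N + 2)%nat - P))%C by ring.
    eapply Rle_trans; [apply Cmod_triangle|].
    assert (0 < (/ 2) ^ N) by (apply pow_lt; lra).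
    assert (0 <= M * (Cmod h / r) ^ 3).
    { apply Rmult_le_pos; [lra|]. apply pow_le. apply Rmult_le_pos;
        [apply Cmod_ge_0|left; apply Rinv_0_lt_compat; lra]. }
    nra. }
  intros eps He.
  set (L := 2 * M / (r * r * r)).
  assert (HL : 0 < L).
  { apply Rdiv_lt_0_compat; [lra|]. repeat apply Rmult_lt_0_compat; lra. }
  exists (Rmin (r / 2) (eps / L)); split.
  { apply Rmin_pos; [lra|apply Rdiv_lt_0_compat; lra]. }
  intros h Hh.
  assert (H1 : Cmod h < r / 2) by (eapply Rlt_le_trans; [exact Hh|apply Rmin_l]).
  assert (H2 : Cmod h < eps / L) by (eapply Rlt_le_trans; [exact Hh|apply Rmin_r]).
  eapply Rle_trans; [apply Hlim; lra|].
  replace (2 * M * (Cmod h / r) ^ 3) with (L * Cmod h * (Cmod h * Cmod h))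
    by (unfold L; field; lra).
  assert (Hx := Cmod_ge_0 h).
  apply Rmult_le_compat_r; [nra|].
  apply Rle_trans with (L * (eps / L));
    [apply Rmult_le_compat_l; lra|right; field; lra].
Qed.

Lemma is_derive_C_eps (f : C -> C) (z l : C) :
  @is_derive C_AbsRing C_NormedModule f z l ->
  forall eps, 0 < eps -> exists d, 0 < d /\ forall y, Cmod (y - z) < d ->
    Cmod (f y - f z - l * (y - z))%C <= eps * Cmod (y - z).
Proof.
  intros [_ H] eps He.
  destruct (H z (fun P HP => HP) (mkposreal eps He)) as [d K].
  exists d; split; [apply cond_pos|]; intros y Hy.
  specialize (K y Hy). simpl in K.
  replace (f y - f z - l * (y - z))%C with
    (f y - f z - (y - z) * l)%C by ring. exact K.
Qed.

Lemma is_derive_continuous_Cmod2 (f : C -> C) (z l : C) :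
  @is_derive C_AbsRing C_NormedModule f z l -> continuous_C (fun y => Cmod2 (f y)) z.
Proof.
  intros H. apply lipschitz_continuous_Cmod2.
  destruct (is_derive_C_eps f z l H 1 Rlt_0_1) as [d [Hd K]].
  exists (Cmod l + 1), d; repeat split; [generalize (Cmod_ge_0 l); lra|assumption|].
  intros y Hy. specialize (K y Hy).
  assert (T := Cmod_triangle (f y - f z - l * (y - z)) (l * (y - z))).
  replace (f y - f z - l * (y - z) + l * (y - z))%C with (f y - f z)%C in T by ring.
  rewrite Cmod_mult in T. lra.
Qed.

Lemma is_derive_line (f : C -> C) (k z h l : C) (t : R) :
  @is_derive C_AbsRing C_NormedModule f (z + RtoC t * h)%C l ->
  is_derive (fun s : R => Re (k * f (z + RtoC s * h)%C)) t (Re (k * (l * h))).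
Proof.
  intros H. apply is_derive_Reals. intros eps He.
  set (N := Cmod k * Cmod h + 1).
  assert (HN : 1 <= N)
    by (unfold N; generalize (Cmod_ge_0 k) (Cmod_ge_0 h); nra).
  destruct (is_derive_C_eps _ _ _ H (eps / (2 * N))) as [d [Hd K]].
  { apply Rdiv_lt_0_compat; lra. }
  assert (Hd' : 0 < d / (Cmod h + 1)).
  { apply Rdiv_lt_0_compat; [lra|generalize (Cmod_ge_0 h); lra]. }
  exists (mkposreal _ Hd'); intros u Hu Hud; simpl in Hud; cbv beta.
  set (y := (z + RtoC t * h)%C) in *.
  set (y' := (z + RtoC (t + u) * h)%C).
  assert (Ey : (y' - y)%C = (RtoC u * h)%C)
    by (unfold y', y; rewrite RtoC_plus; ring).
  assert (Em : Cmod (y' - y) = Rabs u * Cmod h) by (rewrite Ey, Cmod_mult, Cmod_R; reflexivity).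
  assert (Hh := Cmod_ge_0 h).
  assert (Hup : 0 < Rabs u) by (apply Rabs_pos_lt; assumption).
  assert (Hdd : Cmod (y' - y) < d).
  { rewrite Em. apply Rlt_le_trans with (d / (Cmod h + 1) * (Cmod h + 1)).
    - nra.
    - right; field; lra. }
  specialize (K y' Hdd). rewrite Em in K.
  replace ((Re (k * f y') - Re (k * f y)) / u - Re (k * (l * h))) with
    (Re (k * (f y' - f y - l * (y' - y))) / u).
  - unfold Rdiv; rewrite Rabs_mult, Rabs_inv.
    apply Rle_lt_trans with (Cmod k * (eps / (2 * N) * (Rabs u * Cmod h)) * / Rabs u).
    + apply Rmult_le_compat_r; [left; apply Rinv_0_lt_compat; assumption|].
      eapply Rle_trans; [apply re_le_Cmod|]. rewrite Cmod_mult.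
      apply Rmult_le_compat_l; [apply Cmod_ge_0|exact K].
    + replace (Cmod k * (eps / (2 * N) * (Rabs u * Cmod h)) * / Rabs u) with
        (eps / (2 * N) * (Cmod k * Cmod h)) by (field; lra).
      apply Rle_lt_trans with (eps / (2 * N) * N).
      * apply Rmult_le_compat_l; [left; apply Rdiv_lt_0_compat; lra|unfold N; lra].
      * replace (eps / (2 * N) * N) with (eps / 2) by (field; lra). lra.
  - rewrite Ey.
    replace (k * (f y' - f y - l * (RtoC u * h)))%C with
      (k * f y' + (RtoC (-1) * (k * f y) + RtoC (- u) * (k * (l * h))))%C.
    + rewrite !re_plus, !re_scal_l. field; assumption.
    + change (RtoC (-1)) with (RtoC (- (1))). rewrite !RtoC_opp. ring.
Qed.

(** Taylor's formula with Peano remainder.  The mean value theorem is applied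
to the real part of the remainder along the segment, after multiplication by
the conjugate of the remainder at its endpoint. *)
Lemma solution_jet (f f1 f2 : C -> C) (z : C) (r : R) :
  0 < r ->
  (forall y, Cmod (y - z) < r ->
     @is_derive C_AbsRing C_NormedModule f y (f1 y)) ->
  @is_derive C_AbsRing C_NormedModule f1 z (f2 z) ->
  jet f z (f z) (f1 z) (RtoC (/ 2) * f2 z).
Proof.
  intros Hr Hf Hf1 eps He.
  destruct (is_derive_C_eps _ _ _ Hf1 eps He) as [d [Hd K]].
  exists (Rmin r d); split; [apply Rmin_pos; assumption|]; intros h Hh.
  assert (H1 : Cmod h < r) by (eapply Rlt_le_trans; [exact Hh|apply Rmin_l]).
  assert (H2 : Cmod h < d) by (eapply Rlt_le_trans; [exact Hh|apply Rmin_r]).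
  set (w := (f (z + h) - (f z + f1 z * h + RtoC (/ 2) * f2 z * (h * h)))%C).
  set (k := Cconj w).
  set (g := fun s : R => Re (k * f (z + RtoC s * h)%C)).
  set (al := Re (k * (f1 z * h))). set (be := Re (k * (f2 z * (h * h)))).
  assert (Hx := Cmod_ge_0 h).
  assert (Hin : forall t, 0 <= t <= 1 -> Cmod (z + RtoC t * h - z) <= t * Cmod h).
  { intros t Ht. replace (z + RtoC t * h - z)%C with (RtoC t * h)%C by ring.
    rewrite Cmod_mult, Cmod_R, Rabs_pos_eq; lra. }
  assert (Hg : forall t, 0 <= t <= 1 ->
    is_derive (fun s => g s - al * s - be * (s * s) / 2) t
      (Re (k * (f1 (z + RtoC t * h)%C * h)) - al - be * t)).
  { intros t Ht.
    assert (Hgd := is_derive_line f k z h (f1 (z + RtoC t * h)%C) t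
      ltac:(apply Hf; specialize (Hin t Ht); nra)).
    apply (is_derive_minus (V := R_NormedModule)
      (fun s => g s - al * s) (fun s => be * (s * s) / 2)).
    - apply (is_derive_minus (V := R_NormedModule) g (fun s => al * s)).
      + exact Hgd.
      + auto_derive; [trivial|ring].
    - auto_derive; [trivial|field]. }
  destruct (MVT_gen (fun s => g s - al * s - be * (s * s) / 2) 0 1
    (fun t => Re (k * (f1 (z + RtoC t * h)%C * h)) - al - be * t)) as [c [Hc Heq]].
  { intros t Ht. apply Hg. rewrite Rmin_left, Rmax_right in Ht by lra. lra. }
  { intros t Ht. rewrite Rmin_left, Rmax_right in Ht by lra.
    apply derivable_continuous_pt.
    exists (Re (k * (f1 (z + RtoC t * h)%C * h)) - al - be * t).
    apply is_derive_Reals, Hg; assumption. }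
  rewrite Rmin_left, Rmax_right in Hc by lra.
  cbv beta in Heq.
  assert (E1 : g 1 - g 0 - al - be / 2 = Cmod w * Cmod w).
  { unfold g, al, be.
    replace (z + RtoC 1 * h)%C with (z + h)%C by ring.
    replace (z + RtoC 0 * h)%C with z by ring.
    assert (Ew : (k * f (z + h))%C = (k * f z + (k * (f1 z * h) +
      (RtoC (/ 2) * (k * (f2 z * (h * h))) + RtoC (Cmod w * Cmod w))))%C).
    { rewrite <- Cmod_Cconj_mult. fold k. unfold w; ring. }
    rewrite Ew, !re_plus, re_scal_l. 
    change (Re (RtoC (Cmod w * Cmod w))) with (Cmod w * Cmod w). field. }
  assert (E2 : Re (k * (f1 (z + RtoC c * h)%C * h)) - al - be * c <=
    Cmod w * (eps * (Cmod h * Cmod h))).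
  { set (y := (z + RtoC c * h)%C).
    assert (Ey : (y - z)%C = (RtoC c * h)%C) by (unfold y; ring).
    specialize (Hin c Hc). fold y in Hin.
    specialize (K y ltac:(nra)).
    replace (Re (k * (f1 y * h)) - al - be * c) with
      (Re (k * h * (f1 y - f1 z - f2 z * (y - z)))).
    - eapply Rle_trans; [apply Rle_abs|]. eapply Rle_trans; [apply re_le_Cmod|].
      rewrite !Cmod_mult. unfold k; rewrite Cmod_conj, Rmult_assoc.
      apply Rmult_le_compat_l; [apply Cmod_ge_0|].
      replace (eps * (Cmod h * Cmod h)) with (Cmod h * (eps * Cmod h)) by ring.
      apply Rmult_le_compat_l; [assumption|].
      eapply Rle_trans; [exact K|]. apply Rmult_le_compat_l; [lra|nra].
    - unfold al, be. rewrite Ey.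
      replace (k * h * (f1 y - f1 z - f2 z * (RtoC c * h)))%C with
        (k * (f1 y * h) + (RtoC (-1) * (k * (f1 z * h)) +
          RtoC (- c) * (k * (f2 z * (h * h)))))%C.
      + rewrite !re_plus, !re_scal_l. ring.
      + change (RtoC (-1)) with (RtoC (- (1))). rewrite !RtoC_opp. ring. }
  assert (E3 : Cmod w * Cmod w <= Cmod w * (eps * (Cmod h * Cmod h))) by lra.
  assert (Hw := Cmod_ge_0 w).
  fold w. apply Rnot_lt_le; intros Hlt.
  assert (0 <= eps * (Cmod h * Cmod h)) by (apply Rmult_le_pos; nra). nra.
Qed.

(** * Maximum modulus, orders and upper limits at 0 *)

Lemma M0_upper (f : C -> C) (r b : R) :
  0 < r -> (forall z, Cmod z = r -> Cmod (f z) <= b) -> M0 r f <= b.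
Proof.
  intros Hr Hb. unfold M0.
  destruct (Lub_Rbar_correct (fun y => exists z : C, Cmod z = r /\ y = Cmod (f z)))
    as [H1 H2].
  set (L := Lub_Rbar _) in *.
  assert (HLb : Rbar_le L b).
  { apply H2. intros y [z [Hz ->]]. apply Hb, Hz. }
  assert (HL0 : Rbar_le (Cmod (f (RtoC r))) L).
  { apply H1. exists (RtoC r); split; [|reflexivity].
    rewrite Cmod_R, Rabs_pos_eq; lra. }
  destruct L as [l| |]; simpl in *; [exact HLb|contradiction|contradiction].
Qed.

Lemma M0_lower (f : C -> C) (r : R) (z : C) :
  (forall y, Cmod y = r -> has_jet f y) -> Cmod z = r -> Cmod (f z) <= M0 r f.
Proof.
  intros HJ Hz.
  destruct (bounded_on_circle f r) as [M [_ HM]].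
  { intros y Hy; apply has_jet_continuous_Cmod2, HJ, Hy. }
  unfold M0.
  destruct (Lub_Rbar_correct (fun y => exists z : C, Cmod z = r /\ y = Cmod (f z)))
    as [H1 H2].
  set (L := Lub_Rbar _) in *.
  assert (HLb : Rbar_le L M).
  { apply H2. intros y [y' [Hy ->]]. apply HM, Hy. }
  assert (HL0 : Rbar_le (Cmod (f z)) L).
  { apply H1. exists z; split; [exact Hz|reflexivity]. }
  destruct L as [l| |]; simpl in *; [exact HL0|contradiction|contradiction].
Qed.

Lemma logp_le (x y : R) : 0 <= y -> x <= exp y -> logp x <= y.
Proof.
  intros Hy Hx. unfold logp. apply Rmax_lub; [|assumption].
  destruct (Rlt_dec 0 x) as [H|H].
  - rewrite <- (ln_exp y). apply ln_le; assumption.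
  - unfold ln. destruct (Rlt_dec 0 x); [contradiction|assumption].
Qed.

Lemma le_exp_logp (x y : R) : logp x <= y -> x <= exp y.
Proof.
  intros H. destruct (Rlt_dec 0 x) as [H0|H0].
  - rewrite <- (exp_ln x) by assumption. apply exp_le.
    eapply Rle_trans; [apply Rmax_l|exact H].
  - generalize (exp_pos y); lra.
Qed.

Lemma Rbar_glb_correct (E : Rbar -> Prop) : Rbar_is_glb E (Rbar_glb E).
Proof. unfold Rbar_glb. apply proj2_sig. Qed.

Lemma LimSup_at_0_lt (g : R -> R) (c : R) :
  Rbar_lt (LimSup (at_right 0) g) c ->
  exists y, y < c /\ exists eta, 0 < eta /\ forall r, 0 < r < eta -> g r <= y.
Proof.
  intros H. apply NNPP; intros Hno.
  apply (Rbar_lt_not_le _ _ H).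
  apply (proj2 (Rbar_glb_correct _)). intros L [V [HV ->]].
  apply Rbar_not_lt_le. intros HL. apply Hno.
  destruct HV as [eta Heta].
  destruct (Lub_Rbar_correct (fun y => exists r : R, V r /\ y = g r)) as [H1 _].
  set (L := Lub_Rbar _) in *.
  assert (Hin : forall r, 0 < r < eta -> Rbar_le (g r) L).
  { intros r Hr. apply H1. exists r; split; [|reflexivity].
    apply Heta; [|lra]. change (Rabs (r - 0) < eta).
    rewrite Rminus_0_r, Rabs_pos_eq; lra. }
  exists (match L with Finite l => l | _ => c - 1 end).
  destruct L as [l| |]; simpl in *.
  - split; [exact HL|]. exists eta; split; [apply cond_pos|exact Hin].
  - contradiction.
  - split; [lra|]. exists eta; split; [apply cond_pos|].
    intros r Hr; destruct (Hin r Hr).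
Qed.

Lemma LimSup_at_0_le (g : R -> R) (c : R) :
  (forall eps, 0 < eps -> exists eta, 0 < eta /\
     forall r, 0 < r < eta -> g r <= c + eps) ->
  Rbar_le (LimSup (at_right 0) g) c.
Proof.
  intros H. apply Rbar_not_lt_le. intros Hlt.
  assert (Hex : exists eps, 0 < eps /\ Rbar_lt (c + eps) (LimSup (at_right 0) g)).
  { destruct (LimSup (at_right 0) g) as [l| |]; simpl in *.
    - exists ((l - c) / 2); lra.
    - exists 1; split; [lra|trivial].
    - contradiction. }
  destruct Hex as [eps [He Hlt']].
  destruct (H eps He) as [eta [Heta K]].
  apply (Rbar_lt_not_le _ _ Hlt').
  eapply Rbar_le_trans;
    [apply (proj1 (Rbar_glb_correct _));
     exists (fun r => 0 < r < eta); split; [|reflexivity]|].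
  - exists (mkposreal eta Heta). intros y Hy Hy0.
    change (Rabs (y - 0) < eta) in Hy. rewrite Rminus_0_r in Hy.
    apply Rabs_lt_between in Hy; lra.
  - apply (proj2 (Lub_Rbar_correct _)). intros y [r [Hr ->]]. apply K, Hr.
Qed.

(** Common to the order and to the hyper-order, with [F] an iterate of [logp]. *)
Lemma growth_lt_bound (F : R -> R) (G : C -> C) (rho c : R) :
  0 < rho -> (forall z, punctured_disc rho z -> has_jet G z) ->
  Rbar_lt (LimSup (at_right 0) (fun r => F (M0 r G) / - ln r)) c ->
  exists y, y < c /\ exists eta, 0 < eta /\ forall be z, y <= be ->
    0 < Cmod z < eta ->
    exists M, Cmod (G z) <= M /\ F M <= be * - ln (Cmod z).
Proof.
  intros Hrho HJ Hlt. destruct (LimSup_at_0_lt _ _ Hlt) as [y [Hy [eta [Heta K]]]].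
  exists y; split; [assumption|]. exists (Rmin eta (Rmin rho 1)); split.
  { repeat apply Rmin_pos; lra. }
  intros be z Hbe [Hz Hz2].
  assert (H1 := Rlt_le_trans _ _ _ Hz2 (Rmin_l _ _)).
  assert (H2 := Rlt_le_trans _ _ _ Hz2 (Rmin_r _ _)).
  assert (H3 := Rlt_le_trans _ _ _ H2 (Rmin_l _ _)).
  assert (H4 := Rlt_le_trans _ _ _ H2 (Rmin_r _ _)).
  assert (Hl : 0 < - ln (Cmod z)).
  { generalize (ln_increasing _ _ Hz H4). rewrite ln_1; lra. }
  exists (M0 (Cmod z) G); split.
  - apply M0_lower; [|reflexivity].
    intros w Hw. apply HJ. unfold punctured_disc; lra.
  - apply Rle_trans with (y * - ln (Cmod z)); [|apply Rmult_le_compat_r; lra].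
    specialize (K (Cmod z) (conj Hz H1)).
    apply Rmult_le_compat_r with (r := - ln (Cmod z)) in K; [|lra].
    unfold Rdiv in K. rewrite Rmult_assoc, Rinv_l, Rmult_1_r in K by lra. exact K.
Qed.

Lemma order0_lt_bound (G : C -> C) (rho c : R) :
  0 < rho -> (forall z, punctured_disc rho z -> has_jet G z) ->
  Rbar_lt (order0 G) c ->
  exists y, y < c /\ exists eta, 0 < eta /\ forall be z, y <= be ->
    0 < Cmod z < eta -> Cmod (G z) <= exp (exp (be * - ln (Cmod z))).
Proof.
  intros Hrho HJ Hlt.
  destruct (growth_lt_bound (fun M => logp (logp M)) G rho c Hrho HJ Hlt)
    as [y [Hy [eta [Heta K]]]].
  exists y; split; [assumption|]. exists eta; split; [assumption|].
  intros be z Hbe Hz. destruct (K be z Hbe Hz) as [M [HM HF]].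
  eapply Rle_trans; [exact HM|]. do 2 apply le_exp_logp; exact HF.
Qed.

Lemma hyper_order0_lt_bound (G : C -> C) (rho c : R) :
  0 < rho -> (forall z, punctured_disc rho z -> has_jet G z) ->
  Rbar_lt (hyper_order0 G) c ->
  exists y, y < c /\ exists eta, 0 < eta /\ forall be z, y <= be ->
    0 < Cmod z < eta -> Cmod (G z) <= exp (exp (exp (be * - ln (Cmod z)))).
Proof.
  intros Hrho HJ Hlt.
  destruct (growth_lt_bound (fun M => logp (logp (logp M))) G rho c Hrho HJ Hlt)
    as [y [Hy [eta [Heta K]]]].
  exists y; split; [assumption|]. exists eta; split; [assumption|].
  intros be z Hbe Hz. destruct (K be z Hbe Hz) as [M [HM HF]].
  eapply Rle_trans; [exact HM|]. do 3 apply le_exp_logp; exact HF.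
Qed.

Lemma Rbar_max_lt (x y z : Rbar) :
  Rbar_lt (Rbar_max x y) z -> Rbar_lt x z /\ Rbar_lt y z.
Proof.
  unfold Rbar_max. destruct (Rbar_le_dec x y) as [H|H]; intros Hz; split;
    try assumption.
  - eapply Rbar_le_lt_trans; eassumption.
  - eapply Rbar_lt_trans; [apply Rbar_not_le_lt, H|exact Hz].
Qed.

(** * The hyper-order is at most n *)

Lemma is_derive_line_Cmod2 (f : C -> C) (z h l : C) (t : R) :
  @is_derive C_AbsRing C_NormedModule f (z + RtoC t * h)%C l ->
  is_derive (fun s : R => Cmod2 (f (z + RtoC s * h)%C)) t
    (2 * Re (Cconj (f (z + RtoC t * h)%C) * (l * h))).
Proof.
  intros H.
  assert (H1 := is_derive_line f 1 z h l t H).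
  assert (H2 := is_derive_line f (- Ci) z h l t H).
  set (g1 := fun s : R => Re (1 * f (z + RtoC s * h)%C)) in *.
  set (g2 := fun s : R => Re (- Ci * f (z + RtoC s * h)%C)) in *.
  apply (is_derive_ext (fun s => g1 s * g1 s + g2 s * g2 s)).
  { intros s. unfold g1, g2, Cmod2. rewrite Cmod_sqr.
    destruct (f (z + RtoC s * h)%C) as [u v]. unfold Re; simpl. ring. }
  assert (Hs := is_derive_plus (V := R_NormedModule) _ _ _ _ _
    (is_derive_mult (K := R_AbsRing) g1 g1 t _ _ H1 H1 Rmult_comm)
    (is_derive_mult (K := R_AbsRing) g2 g2 t _ _ H2 H2 Rmult_comm)).
  match type of Hs with is_derive _ _ ?d => match goal with
    |- is_derive _ _ ?e => replace e with d; [exact Hs|] end end.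
  unfold g1, g2, plus, mult; simpl.
  destruct (f (z + RtoC t * h)%C) as [u v]. destruct l, h. unfold Re; simpl. ring.
Qed.

(** The energy [E = |f|^2 + |f1|^2] satisfies [|E'| <= (1 + 2 al + be) E], so
[E] times [exp ((1 + 2 al + be) t)] is nondecreasing in [t]. *)
Lemma gronwall_ray (f f1 f2 A Q : C -> C) (e : C) (r r0 al be : R) :
  Cmod e = 1 -> r < r0 -> 0 <= al -> 0 <= be ->
  (forall t, r <= t <= r0 -> let z := (0 + RtoC t * e)%C in
     @is_derive C_AbsRing C_NormedModule f z (f1 z) /\
     @is_derive C_AbsRing C_NormedModule f1 z (f2 z) /\
     (f2 z + A z * f1 z + Q z * f z)%C = RtoC 0 /\
     Cmod (A z) <= al /\ Cmod (Q z) <= be) ->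
  Cmod2 (f (0 + RtoC r * e)%C) <=
    (Cmod2 (f (0 + RtoC r0 * e)%C) + Cmod2 (f1 (0 + RtoC r0 * e)%C)) *
    exp ((1 + 2 * al + be) * (r0 - r)).
Proof.
  intros He Hr Hal Hbe H.
  set (c := 1 + 2 * al + be).
  set (E := fun t : R => Cmod2 (f (0 + RtoC t * e)%C) + Cmod2 (f1 (0 + RtoC t * e)%C)).
  set (dE := fun t : R => let z := (0 + RtoC t * e)%C in
    2 * Re (Cconj (f z) * (f1 z * e)) + 2 * Re (Cconj (f1 z) * (f2 z * e))).
  assert (HE : forall t, r <= t <= r0 -> is_derive E t (dE t)).
  { intros t Ht. destruct (H t Ht) as [H1 [H2 _]].
    apply (is_derive_plus (V := R_NormedModule));
      apply is_derive_line_Cmod2; assumption. }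
  assert (HdE : forall t, r <= t <= r0 -> 0 <= dE t + c * E t).
  { intros t Ht. destruct (H t Ht) as [_ [_ [Heq [HA HQ]]]].
    unfold dE, E. set (z := (0 + RtoC t * e)%C) in *. cbv zeta in *.
    assert (T1 : Rabs (Re (Cconj (f z) * (f1 z * e))) <= Cmod (f z) * Cmod (f1 z)).
    { eapply Rle_trans; [apply re_le_Cmod|].
      rewrite !Cmod_mult, Cmod_conj, He; lra. }
    assert (T2 : Rabs (Re (Cconj (f1 z) * (f2 z * e))) <= Cmod (f1 z) * Cmod (f2 z)).
    { eapply Rle_trans; [apply re_le_Cmod|].
      rewrite !Cmod_mult, Cmod_conj, He; lra. }
    assert (T3 : Cmod (f2 z) <= al * Cmod (f1 z) + be * Cmod (f z)).
    { replace (f2 z) with (- (A z * f1 z + Q z * f z))%C.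
      - rewrite Cmod_opp. eapply Rle_trans; [apply Cmod_triangle|].
        rewrite !Cmod_mult.
        generalize (Cmod_ge_0 (f1 z)) (Cmod_ge_0 (f z)); intros.
        apply Rplus_le_compat; apply Rmult_le_compat_r; assumption.
      - replace (f2 z) with (f2 z + A z * f1 z + Q z * f z -
          (A z * f1 z + Q z * f z))%C by ring. rewrite Heq; ring. }
    apply Rabs_le_between in T1. apply Rabs_le_between in T2.
    unfold c, Cmod2.
    assert (Hx := Cmod_ge_0 (f z)). assert (Hy := Cmod_ge_0 (f1 z)).
    set (x := Cmod (f z)) in *. set (y := Cmod (f1 z)) in *.
    assert (y * Cmod (f2 z) <= y * (al * y + be * x)) by (apply Rmult_le_compat_l; lra).
    assert (2 * (x * y) <= x * x + y * y)
      by (generalize (Rle_0_sqr (x - y)); unfold Rsqr; lra).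
    assert (be * (2 * (x * y)) <= be * (x * x + y * y)) by (apply Rmult_le_compat_l; lra).
    assert (0 <= al * (x * x)) by (apply Rmult_le_pos, Rmult_le_pos; assumption).
    assert (0 <= al * (y * y)) by (apply Rmult_le_pos, Rmult_le_pos; assumption).
    lra. }
  set (F := fun t => E t * exp (c * t)).
  assert (HF : forall t, r <= t <= r0 ->
    is_derive F t ((dE t + c * E t) * exp (c * t))).
  { intros t Ht. unfold F.
    assert (Hx : is_derive (fun s => exp (c * s)) t (c * exp (c * t)))
      by (auto_derive; [trivial|ring]).
    assert (Hs := is_derive_mult (K := R_AbsRing) E _ t _ _ (HE t Ht) Hx Rmult_comm).
    match type of Hs with is_derive _ _ ?d => match goal with
      |- is_derive _ _ ?e => replace e with d; [exact Hs|] end end.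
    unfold plus, mult; simpl. ring. }
  destruct (MVT_gen F r r0 (fun t => (dE t + c * E t) * exp (c * t))) as [t [Ht Heq]].
  { intros t Ht. apply HF. rewrite Rmin_left, Rmax_right in Ht by lra. lra. }
  { intros t Ht. rewrite Rmin_left, Rmax_right in Ht by lra.
    apply derivable_continuous_pt. eexists. apply is_derive_Reals, HF; assumption. }
  rewrite Rmin_left, Rmax_right in Ht by lra.
  assert (Hpos : 0 <= (dE t + c * E t) * exp (c * t) * (r0 - r)).
  { repeat apply Rmult_le_pos; [apply HdE; assumption|left; apply exp_pos|lra]. }
  assert (HFF : F r <= F r0) by lra. unfold F in HFF.
  change (Cmod2 (f (0 + RtoC r * e)%C) <= E r0 * exp (c * (r0 - r))).
  assert (HEr : Cmod2 (f (0 + RtoC r * e)%C) <= E r).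
  { unfold E. generalize (Cmod2_pos (f1 (0 + RtoC r * e)%C)); lra. }
  eapply Rle_trans; [exact HEr|].
  replace (c * (r0 - r)) with (c * r0 + - (c * r)) by ring.
  rewrite exp_plus, exp_Ropp.
  assert (Hep := exp_pos (c * r)).
  replace (E r) with (E r * exp (c * r) * / exp (c * r)) by (field; lra).
  rewrite <- Rmult_assoc. apply Rmult_le_compat_r;
    [left; apply Rinv_0_lt_compat; assumption|exact HFF].
Qed.

(** With [x = - ln r], the coefficients are at most [exp ((1 + |b|) exp (n x))]
for [r <= |z| <= r0].  Gronwall from the circle [|z| = r0] inwards makes
[ln |f|] at most a constant multiple of this, and [exp (eps x)] absorbs all the
constants once [r] is small. *)
Lemma hyper_order_upper (b : C) (n : nat) (rho r0 be : R) (A B f f1 f2 : C -> C) :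
  0 < r0 -> r0 < rho -> r0 <= 1 -> 0 <= be <= INR n ->
  (forall z, punctured_disc rho z ->
    @is_derive C_AbsRing C_NormedModule f z (f1 z) /\
    @is_derive C_AbsRing C_NormedModule f1 z (f2 z) /\
    (f2 z + A z * f1 z + B z * Cexp (b / z ^ n) * f z)%C = RtoC 0) ->
  (forall z, 0 < Cmod z <= r0 -> Cmod (A z) <= exp (exp (be * - ln (Cmod z))) /\
     Cmod (B z) <= exp (exp (be * - ln (Cmod z)))) ->
  (forall z, Cmod z = r0 -> continuous_C (fun y => Cmod2 (f y)) z /\
     continuous_C (fun y => Cmod2 (f1 y)) z) ->
  forall eps, 0 < eps -> exists eta, 0 < eta /\ forall r, 0 < r < eta ->
    logp (logp (logp (M0 r f))) / - ln r <= INR n + eps.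
Proof.
  intros Hr0 Hr0rho Hr01 Hbe Hsol HAB Hcont eps He.
  destruct (bounded_on_circle f r0) as [M [HM HfM]]; [apply Hcont|].
  destruct (bounded_on_circle f1 r0) as [M1 [HM1 HfM1]]; [apply Hcont|].
  set (C0 := 1 + M * M + M1 * M1).
  assert (HC0 : 1 <= C0) by (unfold C0; nra).
  assert (HlC0 : 0 <= ln C0) by (rewrite <- ln_1; apply ln_le; lra).
  set (H0 := 1 + Cmod b + ln (4 + ln C0)).
  assert (Hb := Cmod_ge_0 b).
  assert (Hl4 : 0 <= ln (4 + ln C0)) by (rewrite <- ln_1; apply ln_le; lra).
  assert (HH0 : 1 <= H0) by (unfold H0; lra).
  assert (HlH0 : 0 <= ln H0) by (rewrite <- ln_1; apply ln_le; lra).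
  exists (Rmin r0 (Rmin (exp (- (ln H0 / eps))) 1)); split.
  { repeat apply Rmin_pos; try lra; apply exp_pos. }
  intros r [Hr Hr2].
  assert (Hrr0 : r < r0) by (eapply Rlt_le_trans; [exact Hr2|apply Rmin_l]).
  assert (Hrx : r < exp (- (ln H0 / eps))) by (eapply Rlt_le_trans;
    [exact Hr2|eapply Rle_trans; [apply Rmin_r|apply Rmin_l]]).
  assert (Hr1 : r < 1) by lra.
  set (x := - ln r).
  assert (Hx : 0 < x).
  { unfold x. generalize (ln_increasing r 1 Hr Hr1). rewrite ln_1; lra. }
  assert (Hxl : ln H0 <= eps * x).
  { apply ln_increasing in Hrx; [|assumption]. rewrite ln_exp in Hrx.
    assert (ln H0 / eps < x) by (unfold x; lra).
    replace (ln H0) with (eps * (ln H0 / eps)) by (field; lra).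
    apply Rmult_le_compat_l; lra. }
  set (y := exp (INR n * x)).
  assert (Hnx : 0 <= INR n * x) by (apply Rmult_le_pos; [apply pos_INR|lra]).
  assert (Hy : 1 <= y).
  { apply exp_ge_1; assumption. }
  assert (Hby : 0 <= Cmod b * y) by (apply Rmult_le_pos; lra).
  set (E := exp ((1 + Cmod b) * y)).
  assert (HE : 1 <= E).
  { apply exp_ge_1; lra. }
  assert (Hey : exp y <= E) by (apply exp_le; lra).
  assert (Hbnd : forall z, r <= Cmod z <= r0 -> Cmod (A z) <= exp y /\
    Cmod (B z * Cexp (b / z ^ n)) <= E).
  { intros z Hz. destruct (HAB z ltac:(lra)) as [HA HB].
    assert (Hlz : - ln (Cmod z) <= x).
    { unfold x. generalize (ln_le r (Cmod z) Hr ltac:(lra)); lra. }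
    assert (Hlz0 : 0 <= - ln (Cmod z)).
    { generalize (ln_le (Cmod z) 1 ltac:(lra) ltac:(lra)). rewrite ln_1; lra. }
    assert (Hbey : exp (be * - ln (Cmod z)) <= y).
    { apply exp_le. apply Rmult_le_compat; lra. }
    assert (HBy : Cmod (B z) <= exp y) by (eapply Rle_trans; [exact HB|apply exp_le, Hbey]).
    split; [eapply Rle_trans; [exact HA|apply exp_le, Hbey]|].
    rewrite Cmod_mult, Cmod_Cexp.
    assert (Hz0 : z <> RtoC 0) by (apply Cmod_gt_0; lra).
    assert (HRe : Re (b / z ^ n) <= Cmod b * y).
    { eapply Rle_trans; [apply Rle_abs|]. eapply Rle_trans; [apply re_le_Cmod|].
      rewrite Cmod_div by (apply Cpow_nz; assumption). rewrite Cmod_pow.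
      unfold Rdiv. apply Rmult_le_compat_l; [assumption|].
      rewrite <- pow_inv.
      replace (/ Cmod z) with (exp (- ln (Cmod z)))
        by (rewrite exp_Ropp, exp_ln; [reflexivity|lra]).
      rewrite exp_pow_nat. apply exp_le. apply Rmult_le_compat_l;
        [apply pos_INR|assumption]. }
    unfold E. replace ((1 + Cmod b) * y) with (y + Cmod b * y) by ring.
    rewrite exp_plus. apply Rmult_le_compat;
      [apply Cmod_ge_0|left; apply exp_pos|assumption|apply exp_le, HRe]. }
  assert (Hfz : forall z, Cmod z = r -> Cmod2 (f z) <= C0 * exp (4 * E)).
  { intros z Hz.
    set (e := (RtoC (/ r) * z)%C).
    assert (Hem : Cmod e = 1).
    { unfold e. rewrite Cmod_mult, Cmod_R, Hz, Rabs_pos_eq;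
        [field; lra|left; apply Rinv_0_lt_compat; lra]. }
    assert (Hpt : forall t, 0 <= t -> Cmod (0 + RtoC t * e) = t).
    { intros t Ht. replace (0 + RtoC t * e)%C with (RtoC t * e)%C by ring.
      rewrite Cmod_mult, Cmod_R, Hem, Rabs_pos_eq; lra. }
    assert (HG := gronwall_ray f f1 f2 A (fun z => (B z * Cexp (b / z ^ n))%C)
      e r r0 (exp y) E Hem Hrr0 ltac:(left; apply exp_pos) ltac:(lra)).
    assert (Ez : (0 + RtoC r * e)%C = z).
    { unfold e. rewrite Cplus_0_l, Cmult_assoc, <- RtoC_mult.
      replace (r * / r) with 1 by (field; lra). ring. }
    rewrite Ez in HG.
    eapply Rle_trans; [apply HG|].
    - intros t Ht. cbv zeta.
      assert (Hm := Hpt t ltac:(lra)).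
      destruct (Hsol (0 + RtoC t * e)%C) as [S1 [S2 S3]];
        [unfold punctured_disc; lra|].
      destruct (Hbnd (0 + RtoC t * e)%C ltac:(lra)) as [B1 B2].
      exact (conj S1 (conj S2 (conj S3 (conj B1 B2)))).
    - assert (Hm := Hpt r0 ltac:(lra)).
      assert (T1 := HfM _ Hm). assert (T2 := HfM1 _ Hm).
      apply Rmult_le_compat.
      + generalize (Cmod2_pos (f (0 + RtoC r0 * e)%C))
          (Cmod2_pos (f1 (0 + RtoC r0 * e)%C)); lra.
      + left; apply exp_pos.
      + unfold C0, Cmod2.
        generalize (Cmod_ge_0 (f (0 + RtoC r0 * e)%C))
          (Cmod_ge_0 (f1 (0 + RtoC r0 * e)%C)); nra.
      + apply exp_le. nra. }
  set (Y := exp ((INR n + eps) * x)).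
  assert (HY : H0 * y <= Y).
  { unfold Y. rewrite Rmult_plus_distr_r, exp_plus, Rmult_comm. fold y.
    apply Rmult_le_compat_l; [lra|]. rewrite <- (exp_ln H0) by lra.
    apply exp_le, Hxl. }
  assert (HM0 : M0 r f <= exp (exp Y)).
  { apply M0_upper; [assumption|]. intros z Hz. specialize (Hfz z Hz).
    assert (HEY : (4 + ln C0) * E <= exp Y).
    { rewrite <- (exp_ln (4 + ln C0)) by lra. unfold E. rewrite <- exp_plus.
      apply exp_le. eapply Rle_trans; [|exact HY]. unfold H0. nra. }
    apply Rsqr_incr_0_var; [|left; apply exp_pos]. unfold Rsqr.
    change (Cmod2 (f z) <= exp (exp Y) * exp (exp Y)).
    eapply Rle_trans; [exact Hfz|].
    rewrite <- (exp_ln C0) by lra. rewrite <- !exp_plus. apply exp_le.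
    assert (0 < exp Y) by apply exp_pos. nra. }
  assert (HnY : 0 <= (INR n + eps) * x)
    by (apply Rmult_le_pos; [generalize (pos_INR n); lra|lra]).
  assert (HY0 : 0 <= Y) by (left; apply exp_pos).
  assert (H3 : logp (logp (logp (M0 r f))) <= (INR n + eps) * x).
  { apply logp_le; [assumption|]. apply logp_le; [assumption|].
    apply logp_le; [left; apply exp_pos|exact HM0]. }
  fold x. unfold Rdiv. apply Rmult_le_reg_r with x; [assumption|].
  rewrite Rmult_assoc, Rinv_l, Rmult_1_r by lra. exact H3.
Qed.

(** * The hyper-order is at least n *)

Lemma Cpow_near_1 (n : nat) :
  forall eps, 0 < eps -> exists d, 0 < d /\
    forall v : C, Cmod (v - 1) < d -> Cmod (v ^ n - 1) < eps.
Proof.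
  induction n as [|n IH]; intros eps He.
  - exists 1; split; [lra|]; intros v _. simpl.
    replace (1 - 1)%C with (RtoC 0) by ring. rewrite Cmod_0; assumption.
  - destruct (IH (eps / 4)) as [d [Hd K]]; [lra|].
    exists (Rmin d (Rmin 1 (eps / 2))); split; [repeat apply Rmin_pos; lra|].
    intros v Hv.
    assert (H1 : Cmod (v - 1) < d) by (eapply Rlt_le_trans; [exact Hv|apply Rmin_l]).
    assert (H2 : Cmod (v - 1) < 1) by (eapply Rlt_le_trans;
      [exact Hv|eapply Rle_trans; [apply Rmin_r|apply Rmin_l]]).
    assert (H3 : Cmod (v - 1) < eps / 2) by (eapply Rlt_le_trans;
      [exact Hv|eapply Rle_trans; [apply Rmin_r|apply Rmin_r]]).
    specialize (K v H1).
    replace (v ^ S n - 1)%C with (v * (v ^ n - 1) + (v - 1))%C by (simpl; ring).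
    assert (T := Cmod_triangle (v * (v ^ n - 1)) (v - 1)).
    rewrite Cmod_mult in T.
    assert (Hv2 : Cmod v <= 2).
    { generalize (Cmod_triangle (v - 1) 1). replace (v - 1 + 1)%C with v by ring.
      rewrite Cmod_1; lra. }
    assert (Cmod v * Cmod (v ^ n - 1) <= 2 * (eps / 4)).
    { apply Rmult_le_compat; try apply Cmod_ge_0; lra. }
    lra.
Qed.

(** [p] is an [n]-th root for which [b / p^n] is positive.  Replacing [p] by [z]
multiplies this quotient by [(p / z)^n], which stays close to 1 on a disc whose
radius is a fixed fraction of [s]. *)
Lemma exponential_large_disc (b : C) (n : nat) :
  b <> RtoC 0 -> (0 < n)%nat ->
  exists k, 0 < k <= / 8 /\ forall s, 0 < s -> exists p, Cmod p = s /\
    forall z, Cmod (z - p) <= 2 * (k * s) -> Cmod b / (2 * s ^ n) <= Re (b / z ^ n).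
Proof.
  intros Hb Hn.
  assert (Hbm : 0 < Cmod b) by (apply Cmod_gt_0; assumption).
  assert (HnR : 0 < INR n) by (apply lt_0_INR; assumption).
  destruct (Cpow_near_1 n (/ 2)) as [d [Hd K]]; [lra|].
  exists (Rmin (/ 8) (d / 4)).
  assert (Hk : 0 < Rmin (/ 8) (d / 4)) by (apply Rmin_pos; lra).
  assert (Hk1 := Rmin_l (/ 8) (d / 4)). assert (Hk2 := Rmin_r (/ 8) (d / 4)).
  set (k := Rmin (/ 8) (d / 4)) in *.
  split; [lra|]. intros s Hs.
  destruct (cis_surj (b / RtoC (Cmod b))) as [phi [_ Hphi]].
  { assert (RtoC (Cmod b) <> RtoC 0) by (intros H0; injection H0; lra).
    rewrite Cmod_div, Cmod_R, Rabs_pos_eq by (assumption || lra). field; lra. }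
  set (p := (RtoC s * cis (phi / INR n))%C).
  assert (Hp : Cmod p = s).
  { unfold p. rewrite Cmod_mult, Cmod_cis, Cmod_R, Rabs_pos_eq; lra. }
  exists p; split; [exact Hp|]. intros z Hz.
  assert (Hbp : b = (RtoC (Cmod b) * cis phi)%C).
  { rewrite <- Hphi. field. intros H0; injection H0; lra. }
  assert (Hpn : (p ^ n)%C = (RtoC (s ^ n) * cis phi)%C).
  { unfold p. rewrite Cpow_mult_l, cis_pow, RtoC_pow. do 2 f_equal. field; lra. }
  assert (Hks : k * s <= / 8 * s) by (apply Rmult_le_compat_r; lra).
  assert (Hzm : 3 / 4 * s <= Cmod z).
  { generalize (Cmod_triangle_rev p z). rewrite Cmod_sub_sym, Hp. lra. }
  assert (Hz0 : z <> RtoC 0) by (apply Cmod_gt_0; lra).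
  set (v := (p / z)%C).
  assert (Hv : Cmod (v - 1) < d).
  { replace (v - 1)%C with ((p - z) / z)%C by (unfold v; field; assumption).
    rewrite Cmod_div, Cmod_sub_sym by assumption.
    apply Rmult_lt_reg_r with (Cmod z); [lra|].
    unfold Rdiv; rewrite Rmult_assoc, Rinv_l, Rmult_1_r by lra.
    assert (d * (3 / 4 * s) <= d * Cmod z) by (apply Rmult_le_compat_l; lra).
    assert (k * s <= d / 4 * s) by (apply Rmult_le_compat_r; lra). 
    assert (0 < d * s) by (apply Rmult_lt_0_compat; lra). lra. }
  specialize (K v Hv).
  assert (Hs' : 0 < s ^ n) by (apply pow_lt; assumption).
  assert (Hsn : RtoC (s ^ n) <> RtoC 0) by (intros H0; injection H0; lra).
  assert (Hcis : cis phi <> RtoC 0) by (apply Cmod_gt_0; rewrite Cmod_cis; lra).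
  assert (Hzn : (z ^ n)%C <> RtoC 0) by (apply Cpow_nz; assumption).
  assert (E : (b / z ^ n)%C = (RtoC (Cmod b / s ^ n) * v ^ n)%C).
  { unfold v, Cdiv at 2. rewrite Cpow_mult_l, Cpow_inv, Hpn by assumption.
    rewrite RtoC_div by lra. rewrite Hbp at 1. field; auto. }
  rewrite E, re_scal_l.
  assert (HRe : / 2 <= Re (v ^ n)).
  { replace (v ^ n)%C with (1 + (v ^ n - 1))%C by ring.
    rewrite re_plus. change (Re 1) with 1.
    generalize (re_le_Cmod (v ^ n - 1)). intros H.
    apply Rabs_le_between in H. lra. }
  replace (Cmod b / (2 * s ^ n)) with (Cmod b / s ^ n * / 2) by (field; lra).
  apply Rmult_le_compat_l; [|assumption].
  left; apply Rdiv_lt_0_compat; assumption.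
Qed.

(** The inequality at the radius [s = exp (- x)], with the notation of the
introduction.  [T] bounds [ln |A|], [ln |B|] and [ln ln |f|] for
[s / 4 <= |z| <= r0], and [W = T x] dominates, up to a constant factor, the
logarithms of [K] and of [1 / d]. *)
Lemma scale_inequality (b : C) (n : nat) (rho r0 be : R) (A B f f1 f2 : C -> C) :
  b <> RtoC 0 -> (0 < n)%nat ->
  0 < r0 -> r0 < rho -> r0 <= 1 -> 0 <= be ->
  (forall z, punctured_disc rho z ->
    @is_derive C_AbsRing C_NormedModule f z (f1 z) /\
    @is_derive C_AbsRing C_NormedModule f1 z (f2 z) /\
    (f2 z + A z * f1 z + B z * Cexp (b / z ^ n) * f z)%C = RtoC 0) ->
  (forall z, punctured_disc rho z -> has_jet B z) ->
  not_identically_zero (punctured_disc rho) B ->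
  not_identically_zero (punctured_disc rho) f ->
  (forall z, 0 < Cmod z <= r0 ->
     Cmod (A z) <= exp (exp (be * - ln (Cmod z))) /\
     Cmod (B z) <= exp (exp (be * - ln (Cmod z))) /\
     Cmod (f z) <= exp (exp (exp (be * - ln (Cmod z))))) ->
  exists X0 C2 C3, forall x, X0 <= x ->
    Cmod b * exp (INR n * x) / 2 <= C2 + C3 * (exp (be * (x + 2)) * x).
Proof.
  intros Hb Hn Hr0 Hr0rho Hr01 Hbe Hsol HJB [zB [HzB HB0]] [zf [Hzf Hf0]] Hbnd.
  assert (Hjet : forall z, 0 < Cmod z < rho ->
    jet f z (f z) (f1 z) (RtoC (/ 2) * f2 z)).
  { intros z Hz.
    apply solution_jet with (r := Rmin (Cmod z) (rho - Cmod z)).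
    - apply Rmin_pos; lra.
    - intros y Hy. apply Hsol. unfold punctured_disc.
      assert (H1 := Rlt_le_trans _ _ _ Hy (Rmin_l _ _)).
      assert (H2 := Rlt_le_trans _ _ _ Hy (Rmin_r _ _)).
      generalize (Cmod_triangle_rev y z) (Cmod_triangle_rev z y).
      rewrite (Cmod_sub_sym z y). lra.
    - apply Hsol, Hz. }
  assert (HJf : forall z, 0 < Cmod z < rho -> has_jet f z).
  { intros z Hz; do 3 eexists; apply Hjet, Hz. }
  destruct (exponential_large_disc b n Hb Hn) as [k [Hk Hlarge]].
  unfold punctured_disc in HzB, Hzf.
  set (r1 := Rmin r0 (Rmin (Cmod zB) (Cmod zf)) / 2).
  assert (Hr1 : 0 < r1 /\ r1 < r0 /\ r1 < Cmod zB /\ r1 < Cmod zf).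
  { assert (0 < Rmin r0 (Rmin (Cmod zB) (Cmod zf)))
      by (repeat apply Rmin_pos; lra).
    generalize (Rmin_l r0 (Rmin (Cmod zB) (Cmod zf)))
      (Rmin_r r0 (Rmin (Cmod zB) (Cmod zf)))
      (Rmin_l (Cmod zB) (Cmod zf)) (Rmin_r (Cmod zB) (Cmod zf)).
    unfold r1; lra. }
  destruct (nonzero_on_circle B rho zB r1 HJB HzB HB0 ltac:(lra)) as [wB [HwB HBw]].
  destruct (nonzero_on_circle f rho zf r1 HJf Hzf Hf0 ltac:(lra)) as [wf [Hwf Hfw]].
  destruct (lower_bound_in_disc B rho r0 wB k Hr0rho Hr01 ltac:(lra) HBw Hk HJB)
    as [AB [HAB HlowB]].
  destruct (lower_bound_in_disc f rho r0 wf k Hr0rho Hr01 ltac:(lra) Hfw Hk HJf)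
    as [Af [HAf Hlowf]].
  set (m := Rmin (r1 / 4) (r0 / 4)).
  assert (Hm : 0 < m) by (apply Rmin_pos; lra).
  assert (Hl2 : 0 < ln 2) by (rewrite <- ln_1; apply ln_increasing; lra).
  assert (Hl21 : ln 2 <= 1) by (generalize (ln_le_minus_1 2); lra).
  set (CK := 3 + 2 * ((1 + 2 * Af) * (16 + 2 * AB) / ln 2)).
  exists (Rmax 1 (- ln m)), (ln (152 * (CK * CK) * (16 / k * (16 / k)))),
    (13 + 5 * AB).
  intros x Hx.
  assert (Hx1 : 1 <= x) by (eapply Rle_trans; [apply Rmax_l|exact Hx]).
  assert (Hxm : - ln m <= x) by (eapply Rle_trans; [apply Rmax_r|exact Hx]).
  set (s := exp (- x)).
  assert (Hs : 0 < s) by apply exp_pos.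
  assert (Hsm : s <= m).
  { unfold s. rewrite <- (exp_ln m) by assumption. apply exp_le; lra. }
  assert (Hsr1 : s <= r1 / 4) by (eapply Rle_trans; [exact Hsm|apply Rmin_l]).
  assert (Hsr0 : s <= r0 / 4) by (eapply Rle_trans; [exact Hsm|apply Rmin_r]).
  assert (Hlns : ln (/ s) = x) by (unfold s; rewrite <- exp_Ropp, Ropp_involutive, ln_exp; reflexivity).
  set (T := exp (be * (x + 2))).
  assert (HT : 1 <= T) by (apply exp_ge_1, Rmult_le_pos; lra).
  assert (HxT : x <= T * x) by nra.
  assert (HTT : T <= T * x) by nra.
  assert (Hbz : forall z, s / 4 <= Cmod z <= r0 -> Cmod (A z) <= exp T /\
    Cmod (B z) <= exp T /\ Cmod (f z) <= exp (exp T)).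
  { intros z Hz. destruct (Hbnd z ltac:(lra)) as [H1 [H2 H3]].
    assert (Hle : exp (be * - ln (Cmod z)) <= T).
    { apply exp_le. apply Rmult_le_compat_l; [assumption|].
      assert (H4 : ln (s / 4) <= ln (Cmod z)) by (apply ln_le; lra).
      rewrite ln_div in H4 by lra.
      assert (ln s = - x) by (unfold s; apply ln_exp).
      assert (ln 4 <= 2).
      { replace 4 with (2 * 2) by ring. rewrite ln_mult by lra. lra. }
      lra. }
    assert (Hle2 : exp (exp (be * - ln (Cmod z))) <= exp T) by (apply exp_le, Hle).
    repeat split; [lra|lra|].
    eapply Rle_trans; [exact H3|apply exp_le, Hle2]. }
  destruct (Hlarge s Hs) as [p [Hp Hpz]].
  assert (Hks : 0 < k * s <= s / 8).
  { split; [nra|]. assert (k * s <= / 8 * s) by (apply Rmult_le_compat_r; lra). lra. }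
  destruct (HlowB s p T Hs ltac:(lra) ltac:(lra) Hp HT) as [q [Hqp HBq]].
  { intros z Hz; apply Hbz; lra. }
  rewrite Hlns in HBq.
  set (s' := Cmod q).
  assert (Hs' : 7 / 8 * s <= s' <= 9 / 8 * s).
  { unfold s'. generalize (Cmod_triangle_rev q p) (Cmod_triangle_rev p q).
    rewrite (Cmod_sub_sym p q), Hp. lra. }
  assert (Hnear : forall z t, Cmod (z - q) <= t -> s' - t <= Cmod z <= s' + t).
  { intros z t Hz. unfold s'. generalize (Cmod_triangle_rev z q) (Cmod_triangle_rev q z).
    rewrite (Cmod_sub_sym q z). lra. }
  set (r := k * s).
  (* the radius for which the Hoelder estimate keeps [B] within [|B q| / 2] of
     [B q] on the disc of radius [d] *)
  set (d := r / 16 * exp (- (2 * T + 2 * (AB * T * x)))).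
  assert (HABT : 0 < AB * T * x) by (repeat apply Rmult_lt_0_compat; lra).
  assert (Hdexp : exp (- (2 * T + 2 * (AB * T * x))) <= 1).
  { rewrite <- exp_0. apply exp_le; lra. }
  assert (Hd : 0 < d <= r / 16).
  { unfold d. assert (He := exp_pos (- (2 * T + 2 * (AB * T * x)))).
    unfold r. split; nra. }
  fold r in Hks, Hqp.
  assert (HBd : forall z, Cmod (z - q) <= d ->
    exp (- (AB * T * x)) / 2 <= Cmod (B z)).
  { intros z Hz.
    assert (Hh : Cmod2 (B z - B q) <= 4 * (exp T * exp T) / r * Cmod (z - q)).
    { apply holder_half; [lra|apply exp_pos| | |lra].
      - intros y Hy. specialize (Hnear y r Hy). apply HJB. unfold punctured_disc; lra.
      - intros y Hy. specialize (Hnear y r Hy). apply Hbz; lra. }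
    set (e := exp (- (AB * T * x))) in *.
    assert (He : 0 < e) by apply exp_pos.
    assert (Hdd : 4 * (exp T * exp T) / r * d = (e / 2) * (e / 2)).
    { unfold d. replace (- (2 * T + 2 * (AB * T * x))) with
        (- (AB * T * x) + - (AB * T * x) + (- T + - T)) by ring.
      rewrite !exp_plus. fold e. rewrite exp_Ropp. assert (HeT := exp_pos T).
      field. split; lra. }
    assert (Hh2 : Cmod2 (B z - B q) <= e / 2 * (e / 2)).
    { rewrite <- Hdd. eapply Rle_trans; [exact Hh|]. apply Rmult_le_compat_l; [|lra].
      left; apply Rdiv_lt_0_compat; [|lra]. generalize (exp_pos T); nra. }
    assert (Hh3 : Cmod (B z - B q) <= e / 2).
    { apply Rsqr_incr_0_var; [exact Hh2|lra]. }
    generalize (Cmod_triangle_rev (B q) (B z)). rewrite (Cmod_sub_sym (B q)). lra. }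
  assert (HeT1 : 1 <= exp T) by (apply exp_ge_1; lra).
  destruct (Hlowf s' q (exp T) ltac:(lra) ltac:(lra) ltac:(lra) eq_refl HeT1)
    as [q1 [Hq1 Hfq1]].
  { intros z Hz; apply Hbz; lra. }
  assert (Hlns' : ln (/ s') <= x + 1).
  { assert (Hle : ln (/ s') <= ln (2 * / s)).
    { apply ln_le; [apply Rinv_0_lt_compat; lra|].
      replace (2 * / s) with (/ (s / 2)) by (field; lra).
      apply Rinv_le_contravar; lra. }
    rewrite ln_mult, Hlns in Hle by (try apply Rinv_0_lt_compat; lra). lra. }
  assert (Hlns'0 : 0 <= ln (/ s')).
  { rewrite <- ln_1. apply ln_le; [lra|]. rewrite <- Rinv_1.
    apply Rinv_le_contravar; lra. }
  set (V := Af * exp T * ln (/ s')) in *.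
  assert (HV0 : 0 <= V) by (repeat apply Rmult_le_pos; lra).
  assert (HV : V <= 2 * Af * exp T * x).
  { unfold V. replace (2 * Af * exp T * x) with (Af * exp T * (2 * x)) by ring.
    apply Rmult_le_compat_l; [apply Rmult_le_pos; lra|lra]. }
  destruct (lower_bound_in_smaller_disc f q q1 (4 * r) (d / 2) (exp T) V)
    as [q2 [Hq2 Hfq2]].
  { lra. } { lra. } { lra. } { assumption. }
  { intros z Hz. specialize (Hnear z _ Hz). apply HJf; lra. }
  { intros z Hz. specialize (Hnear z _ Hz). apply Hbz; lra. }
  { eapply Rle_trans; [exact Hq1|]. unfold r.
    assert (k * s' <= k * (2 * s)) by (apply Rmult_le_compat_l; lra). lra. }
  { exact Hfq1. }
  set (a := (exp T + V) * ln (4 * r / (d / 2)) / ln 2) in *.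
  set (W := T * x) in *.
  assert (HW : 1 <= W) by lra.
  assert (HABW : AB * T * x = AB * W) by (unfold W; ring).
  assert (Hlnd : ln (4 * r / (d / 2)) <= (16 + 2 * AB) * W).
  { replace (4 * r / (d / 2)) with (2 * 2 * 2 * 2 * 2 * 2 * 2 *
      exp (2 * T + 2 * (AB * T * x))).
    - rewrite !ln_mult, ln_exp by (repeat apply Rmult_lt_0_compat; try apply exp_pos; lra).
      rewrite HABW. lra.
    - unfold d. rewrite exp_Ropp.
      assert (He := exp_pos (2 * T + 2 * (AB * T * x))). field.
      repeat split; lra. }
  assert (HeTW : exp T <= exp W) by (apply exp_le; lra).
  assert (HWe : W <= exp W) by (generalize (exp_ineq1_le W); lra).
  assert (Hxe : x <= exp W) by lra.
  set (w := exp W) in *.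
  assert (Hw1 : 1 <= w) by lra.
  assert (HabU : exp T + V <= (1 + 2 * Af) * (w * w)).
  { assert (2 * Af * exp T * x <= 2 * Af * (w * w)).
    { rewrite Rmult_assoc. apply Rmult_le_compat_l; [lra|].
      apply Rmult_le_compat; lra. }
    assert (exp T <= w * w) by nra. lra. }
  assert (Hln0 : 0 <= ln (4 * r / (d / 2))).
  { rewrite <- ln_1. apply ln_le; [lra|].
    apply Rmult_le_reg_r with (d / 2); [lra|].
    replace (4 * r / (d / 2) * (d / 2)) with (4 * r) by (field; lra). lra. }
  assert (Hln2 : ln (4 * r / (d / 2)) <= (16 + 2 * AB) * w).
  { eapply Rle_trans; [exact Hlnd|]. apply Rmult_le_compat_l; lra. }
  assert (Ha : a <= (1 + 2 * Af) * (16 + 2 * AB) / ln 2 * (w * w * w)).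
  { unfold a.
    replace ((1 + 2 * Af) * (16 + 2 * AB) / ln 2 * (w * w * w)) with
      (((1 + 2 * Af) * (w * w)) * ((16 + 2 * AB) * w) / ln 2) by (field; lra).
    unfold Rdiv; apply Rmult_le_compat_r; [left; apply Rinv_0_lt_compat; lra|].
    apply Rmult_le_compat; lra. }
  assert (Ha0 : 0 <= a).
  { unfold a, Rdiv. repeat apply Rmult_le_pos; try lra.
    left; apply Rinv_0_lt_compat; lra. }
  destruct (nat_between (2 * (exp T + a)) ltac:(lra)) as [K [HK1 [HK2 HK3]]].
  assert (Hwww : w <= w * w * w).
  { assert (1 <= w * w) by nra. nra. }
  assert (HK : INR K <= CK * (w * w * w)).
  { unfold CK. assert (1 <= w * w * w) by lra. nra. }
  destruct (log_derivative_bound f q q2 d (exp T) a K) as [z [Hz [Hfz Hlog]]].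
  { lra. } { assumption. } { assumption. }
  { intros y Hy. specialize (Hnear y _ Hy). apply HJf; lra. }
  { intros y Hy. specialize (Hnear y _ Hy). apply Hbz; lra. }
  { assumption. } { exact Hfq2. }
  assert (Hzr := Hnear z _ Hz).
  destruct (Hlog _ _ _ (Hjet z ltac:(lra))) as [HL1 HL2].
  destruct (Hsol z ltac:(unfold punctured_disc; lra)) as [_ [_ Hode]].
  destruct (Hbz z ltac:(lra)) as [HAz _].
  assert (HQ : Cmod (B z) * exp (Re (b / z ^ n)) <=
    72 * (INR K * INR K) / (d * d) + exp T * (4 * INR K / d)).
  { rewrite <- Cmod_Cexp, <- Cmod_mult.
    replace (B z * Cexp (b / z ^ n))%C with
      (- (RtoC 2 * (RtoC (/ 2) * f2 z / f z) + A z * (f1 z / f z)))%C.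
    - rewrite Cmod_opp. eapply Rle_trans; [apply Cmod_triangle|].
      apply Rplus_le_compat.
      + rewrite Cmod_mult, Cmod_R, Rabs_pos_eq by lra.
        replace (72 * (INR K * INR K) / (d * d)) with
          (2 * (36 * (INR K * INR K) / (d * d))) by (field; lra).
        apply Rmult_le_compat_l; lra.
      + rewrite Cmod_mult. apply Rmult_le_compat; try apply Cmod_ge_0; assumption.
    - replace (RtoC 2 * (RtoC (/ 2) * f2 z / f z))%C with (f2 z / f z)%C.
      + replace (f2 z) with (- (A z * f1 z + B z * Cexp (b / z ^ n) * f z))%C.
        * field; assumption.
        * replace (f2 z) with ((f2 z + A z * f1 z + B z * Cexp (b / z ^ n) * f z) -
            (A z * f1 z + B z * Cexp (b / z ^ n) * f z))%C by ring.
          rewrite Hode; ring.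
      + rewrite RtoC_inv by lra. field. assumption. }
  assert (HRez : Cmod b / (2 * s ^ n) <= Re (b / z ^ n)).
  { apply Hpz. generalize (Cmod_triangle (z - q) (q - p)).
    replace (z - q + (q - p))%C with (z - p)%C by ring. fold r. lra. }
  assert (Hsn : Cmod b / (2 * s ^ n) = Cmod b * exp (INR n * x) / 2).
  { unfold s. rewrite exp_pow_nat, Ropp_mult_distr_r_reverse, exp_Ropp.
    assert (He := exp_pos (INR n * x)). field; lra. }
  rewrite Hsn in HRez.
  set (L := Cmod b * exp (INR n * x) / 2) in *.
  assert (Hlow : exp (- (AB * W)) / 2 * exp L <= Cmod (B z) * exp (Re (b / z ^ n))).
  { rewrite <- HABW. apply Rmult_le_compat.
    - generalize (exp_pos (- (AB * T * x))); lra.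
    - left; apply exp_pos.
    - apply HBd, Hz.
    - apply exp_le, HRez. }
  assert (Hs1 : s <= 1) by lra.
  assert (Hd1 : d <= 1) by lra.
  set (D := 16 / k * exp ((3 + 2 * AB) * W)).
  assert (HD : / d <= D).
  { unfold d, D, r. rewrite exp_Ropp. unfold s. rewrite exp_Ropp.
    replace (/ (k * / exp x / 16 * / exp (2 * T + 2 * (AB * T * x)))) with
      (16 / k * exp (x + (2 * T + 2 * (AB * T * x)))).
    - apply Rmult_le_compat_l; [left; apply Rdiv_lt_0_compat; lra|].
      apply exp_le. rewrite HABW. lra.
    - rewrite exp_plus. assert (He := exp_pos x).
      assert (He' := exp_pos (2 * T + 2 * (AB * T * x))). field. repeat split; lra. }
  assert (Hid : 1 <= / d) by (rewrite <- Rinv_1; apply Rinv_le_contravar; lra).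
  assert (HK1R : 1 <= INR K) by (apply (le_INR 1); assumption).
  assert (Hup : 72 * (INR K * INR K) / (d * d) + exp T * (4 * INR K / d) <=
    76 * w * ((CK * (w * w * w)) * (CK * (w * w * w))) * (D * D)).
  { set (kk := INR K) in *.
    assert (E1 : 72 * (kk * kk) / (d * d) <= 72 * w * (kk * kk) * (/ d * / d)).
    { replace (72 * (kk * kk) / (d * d)) with (72 * (kk * kk) * (/ d * / d))
        by (field; lra).
      apply Rmult_le_compat_r; [nra|]. assert (0 <= kk * kk) by nra. nra. }
    assert (E2 : exp T * (4 * kk / d) <= 4 * w * (kk * kk) * (/ d * / d)).
    { replace (4 * w * (kk * kk) * (/ d * / d)) with
        (w * ((4 * (kk * kk)) * (/ d * / d))) by ring.
      apply Rmult_le_compat; [lra| |lra|].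
      - unfold Rdiv; apply Rmult_le_pos; lra.
      - unfold Rdiv. apply Rmult_le_compat; nra. }
    apply Rle_trans with (76 * w * (kk * kk) * (/ d * / d)); [lra|].
    apply Rmult_le_compat; [|apply Rmult_le_pos; lra| |].
    - repeat apply Rmult_le_pos; lra.
    - apply Rmult_le_compat_l; [lra|]. apply Rmult_le_compat; lra.
    - apply Rmult_le_compat; lra. }
  assert (HCK : 3 <= CK).
  { unfold CK. assert (0 <= (1 + 2 * Af) * (16 + 2 * AB) / ln 2); [|lra].
    unfold Rdiv. repeat apply Rmult_le_pos; try lra.
    left; apply Rinv_0_lt_compat; lra. }
  set (c2 := 152 * (CK * CK) * (16 / k * (16 / k))).
  assert (H16k : 0 < 16 / k) by (apply Rdiv_lt_0_compat; lra).
  assert (Hc2 : 0 < c2) by (unfold c2; repeat apply Rmult_lt_0_compat; lra).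
  assert (Hfin : exp L <= c2 * exp ((13 + 5 * AB) * W)).
  { assert (HH : exp (- (AB * W)) / 2 * exp L <=
      76 * w * ((CK * (w * w * w)) * (CK * (w * w * w))) * (D * D)) by lra.
    assert (HeA := exp_pos (AB * W)).
    apply Rmult_le_compat_l with (r := 2 * exp (AB * W)) in HH; [|lra].
    rewrite exp_Ropp in HH.
    replace (2 * exp (AB * W) * (/ exp (AB * W) / 2 * exp L)) with (exp L) in HH
      by (field; lra).
    eapply Rle_trans; [exact HH|]. right. unfold D, c2.
    replace ((13 + 5 * AB) * W) with (AB * W + (W + (W + W + W) + (W + W + W)) +
      ((3 + 2 * AB) * W + (3 + 2 * AB) * W)) by ring.
    rewrite !exp_plus. fold w. ring. }
  rewrite <- (exp_ln c2) in Hfin by assumption. rewrite <- exp_plus in Hfin.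
  change (L <= ln c2 + (13 + 5 * AB) * W).
  apply Rnot_lt_le; intros Hlt. apply exp_increasing in Hlt. lra.
Qed.

Lemma scale_inequality_false (b be n C2 C3 X0 : R) :
  0 < b -> 0 <= be < n ->
  (forall x, X0 <= x -> b * exp (n * x) / 2 <= C2 + C3 * (exp (be * (x + 2)) * x)) ->
  False.
Proof.
  intros Hb Hbe H.
  set (g := n - be). assert (Hg : 0 < g) by (unfold g; lra).
  set (C4 := (Rabs C2 + Rabs C3) * exp (2 * be)).
  assert (HC4 : 0 <= C4).
  { apply Rmult_le_pos; [|left; apply exp_pos].
    generalize (Rabs_pos C2) (Rabs_pos C3); lra. }
  (* [exp (g x) >= (g x / 2)^2] beats the linear bound [C4 x] at this [x] *)
  set (x := Rmax (Rmax 1 X0) (8 * C4 / (b * (g * g)) + 1)).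
  assert (Hx1 : 1 <= x) by (eapply Rle_trans; [apply Rmax_l|apply Rmax_l]).
  assert (Hx2 : X0 <= x) by (eapply Rle_trans; [apply Rmax_r|apply Rmax_l]).
  assert (Hx3 : 8 * C4 / (b * (g * g)) + 1 <= x) by apply Rmax_r.
  specialize (H x Hx2).
  assert (Hbx : 1 <= exp (be * x)) by (apply exp_ge_1, Rmult_le_pos; lra).
  assert (H2b : 1 <= exp (2 * be)) by (apply exp_ge_1; lra).
  assert (E1 : exp (be * (x + 2)) = exp (2 * be) * exp (be * x))
    by (rewrite <- exp_plus; f_equal; ring).
  assert (E2 : exp (n * x) = exp (g * x) * exp (be * x))
    by (rewrite <- exp_plus; f_equal; unfold g; ring).
  rewrite E1, E2 in H.
  set (u := exp (be * x)) in *. set (v := exp (2 * be)) in *.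
  assert (Hux : 1 <= u * x) by nra.
  assert (Hvux : 1 <= v * (u * x)) by nra.
  assert (HC : C2 + C3 * (v * u * x) <= C4 * (u * x)).
  { unfold C4. replace ((Rabs C2 + Rabs C3) * v * (u * x)) with
      (Rabs C2 * (v * (u * x)) + Rabs C3 * (v * (u * x))) by ring.
    replace (C3 * (v * u * x)) with (C3 * (v * (u * x))) by ring.
    apply Rplus_le_compat.
    - generalize (Rle_abs C2) (Rabs_pos C2); nra.
    - apply Rmult_le_compat_r; [lra|apply Rle_abs]. }
  assert (Hq : g * x / 2 * (g * x / 2) <= exp (g * x)).
  { replace (g * x) with (g * x / 2 + g * x / 2) at 3 by field.
    rewrite exp_plus. assert (0 < g * x) by (apply Rmult_lt_0_compat; lra).
    assert (0 <= g * x / 2) by lra.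
    assert (g * x / 2 <= exp (g * x / 2)) by (generalize (exp_ineq1_le (g * x / 2)); lra).
    apply Rmult_le_compat; assumption. }
  assert (Hk : b * exp (g * x) / 2 <= C4 * x).
  { apply Rmult_le_reg_r with u; [lra|]. lra. }
  assert (Hk2 : b * (g * g) * x * x <= 8 * C4 * x).
  { assert (b * (g * x / 2 * (g * x / 2)) <= b * exp (g * x))
      by (apply Rmult_le_compat_l; lra).
    lra. }
  assert (Hbg : 0 < b * (g * g)) by (apply Rmult_lt_0_compat; nra).
  assert (Hk3 : b * (g * g) * x <= 8 * C4).
  { apply Rmult_le_reg_r with x; lra. }
  apply Rmult_le_compat_l with (r := b * (g * g)) in Hx3; [|lra].
  replace (b * (g * g) * (8 * C4 / (b * (g * g)) + 1)) with
    (8 * C4 + b * (g * g)) in Hx3 by (field; split; lra).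
  lra.
Qed.

(** * The hyper-order is n *)

Theorem corollary4 (b : C) (n : nat) (rho : R) (A B : C -> C)
  (hb : b <> RtoC 0) (hn : (0 < n)%nat) (hrho : 0 < rho)
  (hA : analytic_in (punctured_disc rho) A)
  (hB : analytic_in (punctured_disc rho) B)
  (hB0 : not_identically_zero (punctured_disc rho) B)
  (hAB : Rbar_lt (Rbar_max (order0 A) (order0 B)) (Finite (INR n))) :
  forall f : C -> C,
    analytic_in (punctured_disc rho) f ->
    not_identically_zero (punctured_disc rho) f ->
    is_solution (punctured_disc rho) A
      (fun z => (B z * Cexp (b / z ^ n))%C) f ->
    hyper_order0 f = Finite (INR n).
Proof.
  intros f hf hf0 [f1 [f2 Hsol]].
  assert (HnR : 0 < INR n) by (apply lt_0_INR; assumption).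
  assert (HJA := fun z Hz => analytic_has_jet A z (hA z Hz)).
  assert (HJB := fun z Hz => analytic_has_jet B z (hB z Hz)).
  assert (HJf := fun z Hz => analytic_has_jet f z (hf z Hz)).
  destruct (Rbar_max_lt _ _ _ hAB) as [hA' hB'].
  destruct (order0_lt_bound A rho _ hrho HJA hA') as [yA [HyA [eA [HeA KA]]]].
  destruct (order0_lt_bound B rho _ hrho HJB hB') as [yB [HyB [eB [HeB KB]]]].
  apply Rbar_le_antisym.
  - set (be := Rmax 0 (Rmax yA yB)).
    set (r0 := Rmin (Rmin eA eB) (Rmin rho 1) / 2).
    assert (Hr0 : 0 < r0 /\ r0 < eA /\ r0 < eB /\ r0 < rho /\ r0 <= 1).
    { assert (0 < Rmin (Rmin eA eB) (Rmin rho 1)) by (repeat apply Rmin_pos; lra).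
      generalize (Rmin_l (Rmin eA eB) (Rmin rho 1)) (Rmin_r (Rmin eA eB) (Rmin rho 1))
        (Rmin_l eA eB) (Rmin_r eA eB) (Rmin_l rho 1) (Rmin_r rho 1).
      unfold r0; lra. }
    assert (Hbe : 0 <= be <= INR n).
    { split; [apply Rmax_l|]. repeat apply Rmax_lub; lra. }
    apply LimSup_at_0_le.
    apply (hyper_order_upper b n rho r0 be A B f f1 f2); try lra; [assumption| |].
    + intros z Hz. split; [apply KA; [|lra]|apply KB; [|lra]].
      * eapply Rle_trans; [apply Rmax_l|apply Rmax_r].
      * eapply Rle_trans; [apply Rmax_r|apply Rmax_r].
    + intros z Hz.
      destruct (Hsol z ltac:(unfold punctured_disc; lra)) as [H1 [H2 _]].
      split; eapply is_derive_continuous_Cmod2; eassumption.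
  - apply Rbar_not_lt_le. intros Hlt.
    destruct (hyper_order0_lt_bound f rho _ hrho HJf Hlt) as [yf [Hyf [ef [Hef Kf]]]].
    set (be := Rmax 0 (Rmax yf (Rmax yA yB))).
    set (r0 := Rmin (Rmin ef (Rmin eA eB)) (Rmin rho 1) / 2).
    assert (Hr0 : 0 < r0 /\ r0 < ef /\ r0 < eA /\ r0 < eB /\ r0 < rho /\ r0 <= 1).
    { assert (0 < Rmin (Rmin ef (Rmin eA eB)) (Rmin rho 1))
        by (repeat apply Rmin_pos; lra).
      generalize (Rmin_l (Rmin ef (Rmin eA eB)) (Rmin rho 1))
        (Rmin_r (Rmin ef (Rmin eA eB)) (Rmin rho 1))
        (Rmin_l ef (Rmin eA eB)) (Rmin_r ef (Rmin eA eB))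
        (Rmin_l eA eB) (Rmin_r eA eB) (Rmin_l rho 1) (Rmin_r rho 1).
      unfold r0; lra. }
    assert (Hbe : 0 <= be < INR n).
    { split; [apply Rmax_l|]. unfold be. repeat apply Rmax_lub_lt; lra. }
    assert (Hf : yf <= be) by (eapply Rle_trans; [apply Rmax_l|apply Rmax_r]).
    assert (HA : yA <= be).
    { eapply Rle_trans; [|apply Rmax_r]. eapply Rle_trans; [|apply Rmax_r]. apply Rmax_l. }
    assert (HB : yB <= be).
    { eapply Rle_trans; [|apply Rmax_r]. eapply Rle_trans; [|apply Rmax_r]. apply Rmax_r. }
    destruct (scale_inequality b n rho r0 be A B f f1 f2) as [X0 [C2 [C3 HX]]];
      try assumption; try lra.
    + intros z Hz. repeat split; [apply KA|apply KB|apply Kf]; lra.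
    + apply (scale_inequality_false (Cmod b) be (INR n) C2 C3 X0); try assumption.
      apply Cmod_gt_0; assumption.
Qed.
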